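(* Let $\mathfrak T$ be a triangulated category with at least countable direct sums, let $\mathfrak I$ be a stable homological ideal in $\mathfrak T$ that is compatible with countable direct sums and has enough projective objects, and let $F\colon\mathfrak T\to\mathfrak A$ be the universal $\mathfrak I$-exact stable homological functor. Let $A$ be an object of $\mathfrak A$ of cohomological dimension $2$. Then the set of equivalence classes of liftings of $A$ is in bijection with $\mathrm{Ext}^2_{\mathfrak A}(A,A[-1])$.
   Context: A stable Abelian category is an Abelian category with a suspension automorphism $[1]$ (inverse $[-1]$). A stable homological functor on $\mathfrak T$ is an additive functor to a stable Abelian category that maps exact triangles to exact sequences and commutes with suspensions. A stable homological ideal $\mathfrak I$ is the kernel on morphisms, $\mathfrak I(A,B)=\{f\in\mathfrak T(A,B): H(f)=0\}$, of some stable homological functor $H$. It is compatible with countable direct sums if for countable families the isomorphism $\mathfrak T(\bigoplus A_n,B)\cong\prod\mathfrak T(A_n,B)$ restricts to $\mathfrak I(\bigoplus A_n,B)\cong\prod\mathfrak I(A_n,B)$. An object $P$ is $\mathfrak I$-projective if $\mathfrak I(P,B)=0$ for all $B$. A morphism $f\colon P\to A$ is $\mathfrak I$-epic if the map $A\to\mathrm{cone}(f)$ lies in $\mathfrak I$; there are enough projective objects if every object admits an $\mathfrak I$-epic morphism from an $\mathfrak I$-projective object. An object $B$ is $\mathfrak I$-contractible if $\mathrm{id}_B\in\mathfrak I(B,B)$. A stable homological functor is $\mathfrak I$-exact if it vanishes on $\mathfrak I$; $F$ is universal if every $\mathfrak I$-exact stable homological functor factors through $F$, uniquely up to natural isomorphism,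 by an exact functor commuting with suspensions. An object $A$ of $\mathfrak A$ has cohomological dimension $n$ if it has a projective resolution $0\to P_n\to\dotsb\to P_0\to A\to0$ of length $n$ in $\mathfrak A$. A lifting of $A\in\mathfrak A$ is a pair $(\hat A,\alpha)$ consisting of an object $\hat A$ of $\mathfrak T$ with $\mathfrak T(\hat A,B)=0$ for all $\mathfrak I$-contractible $B$, and an isomorphism $\alpha\colon F(\hat A)\to A$. An equivalence between liftings $(\hat A_1,\alpha_1)$ and $(\hat A_2,\alpha_2)$ is an isomorphism $\varphi\in\mathfrak T(\hat A_1,\hat A_2)$ with $\alpha_1=\alpha_2\circ F(\varphi)$. *)

(* Defs.v *)
From mathcomp Require Import all_boot all_algebra.

Set Implicit Arguments.
Unset Strict Implicit.
Unset Printing Implicit Defensive.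

Import GRing.Theory.
Local Open Scope ring_scope.

Declare Scope cat_scope.
Delimit Scope cat_scope with cat.
Local Open Scope cat_scope.

(* Classically, [zmodType] is just the notion of an abelian group: every type
   carries a decidable equality and a choice operator. *)
Record preadditiveCat := PreadditiveCat {
  obj :> Type;
  hom : obj -> obj -> zmodType;
  idm : forall X, hom X X;
  comp : forall X Y Z, hom Y Z -> hom X Y -> hom X Z;
  compA : forall W X Y Z (h : hom Y Z) (g : hom X Y) (f : hom W X),
    comp h (comp g f) = comp (comp h g) f;
  comp1m : forall X Y (f : hom X Y), comp (idm Y) f = f;
  compm1 : forall X Y (f : hom X Y), comp f (idm X) = f;
  compDl : forall X Y Z (g g' : hom Y Z) (f : hom X Y),
    comp (g + g') f = comp g f + comp g' f;
  compDr : forall X Y Z (g : hom Y Z) (f f' : hom X Y),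
    comp g (f + f') = comp g f + comp g f'
}.

Arguments hom {p} X Y.
Arguments idm {p} X.
Arguments comp {p X Y Z} g f.

Notation "X ~> Y" := (hom X Y) (at level 60, no associativity) : cat_scope.
Notation "g ∘ f" := (comp g f) (at level 40, left associativity) : cat_scope.

Section Morphisms.
Variable C : preadditiveCat.
Implicit Types X Y Z : C.

Definition is_iso X Y (f : X ~> Y) : Prop :=
  exists g : Y ~> X, g ∘ f = idm X /\ f ∘ g = idm Y.

Definition mono X Y (f : X ~> Y) : Prop :=
  forall W (g h : W ~> X), f ∘ g = f ∘ h -> g = h.

Definition epi X Y (f : X ~> Y) : Prop :=
  forall Z (g h : Y ~> Z), g ∘ f = h ∘ f -> g = h.

(* Both initial and terminal; the hom-groups are never empty. *)
Definition zero_object Z : Prop :=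
  (forall X (f g : X ~> Z), f = g) /\ (forall X (f g : Z ~> X), f = g).

Definition is_biproduct X Y S (i1 : X ~> S) (i2 : Y ~> S)
    (p1 : S ~> X) (p2 : S ~> Y) : Prop :=
  [/\ p1 ∘ i1 = idm X, p2 ∘ i2 = idm Y, p1 ∘ i2 = 0, p2 ∘ i1 = 0
    & i1 ∘ p1 + i2 ∘ p2 = idm S].

Definition is_kernel X Y K (f : X ~> Y) (k : K ~> X) : Prop :=
  f ∘ k = 0 /\
  forall W (g : W ~> X), f ∘ g = 0 -> exists! h : W ~> K, k ∘ h = g.

Definition is_cokernel X Y Q (f : X ~> Y) (q : Y ~> Q) : Prop :=
  q ∘ f = 0 /\
  forall W (g : Y ~> W), g ∘ f = 0 -> exists! h : Q ~> W, h ∘ q = g.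

(* The image is the kernel of the cokernel. *)
Definition is_image X Y J (f : X ~> Y) (m : J ~> Y) : Prop :=
  exists Q (q : Y ~> Q), is_cokernel f q /\ is_kernel q m.

Definition exact_at X Y Z (f : X ~> Y) (g : Y ~> Z) : Prop :=
  exists J (m : J ~> Y), is_image f m /\ is_kernel g m.

Definition projective X : Prop :=
  forall Y Z (e : Y ~> Z) (f : X ~> Z), epi e ->
    exists g : X ~> Y, e ∘ g = f.

Definition is_coproduct (X : nat -> C) S (i : forall n, X n ~> S) : Prop :=
  forall Y (f : forall n, X n ~> Y),
    exists! g : S ~> Y, forall n, g ∘ i n = f n.

End Morphisms.

Record additiveCat := AdditiveCat {
  preadd :> preadditiveCat;
  has_zero_object : exists Z : preadd, zero_object Z;
  has_biproducts : forall X Y : preadd,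
    exists (S : preadd) (i1 : X ~> S) (i2 : Y ~> S) (p1 : S ~> X) (p2 : S ~> Y),
      is_biproduct i1 i2 p1 p2
}.

Definition abelian (C : additiveCat) : Prop :=
  [/\ forall (X Y : C) (f : X ~> Y), exists K (k : K ~> X), is_kernel f k,
      forall (X Y : C) (f : X ~> Y), exists Q (q : Y ~> Q), is_cokernel f q,
      forall (X Y : C) (f : X ~> Y), mono f ->
        exists Z (g : Y ~> Z), is_kernel g f
    & forall (X Y : C) (f : X ~> Y), epi f ->
        exists W (g : W ~> X), is_cokernel g f].

Record functor (C D : preadditiveCat) := Functor {
  fobj :> C -> D;
  fmap : forall X Y : C, X ~> Y -> fobj X ~> fobj Y;
  fmap1 : forall X, fmap (idm X) = idm (fobj X);
  fmap_comp : forall (X Y Z : C) (g : Y ~> Z) (f : X ~> Y),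
    fmap (g ∘ f) = fmap g ∘ fmap f;
  fmap_additive : forall X Y : C, zmod_morphism (@fmap X Y)
}.

Arguments fmap {C D} f {X Y} _ : rename.

Definition nat_iso (C D : preadditiveCat) (F G : functor C D) : Prop :=
  exists eta : forall X, F X ~> G X,
    (forall X, is_iso (eta X)) /\
    (forall (X Y : C) (f : X ~> Y), eta Y ∘ fmap F f = fmap G f ∘ eta X).

(* An automorphism of a category is a functor that is bijective on objects and
   on morphisms.  Only the object part X |-> X[-1] of the inverse is recorded,
   as its action on morphisms is then determined. *)
Record stableCat := StableCat {
  addcat :> additiveCat;
  susp : functor addcat addcat;
  desusp : addcat -> addcat;
  suspK : cancel susp desusp;
  desuspK : cancel desusp susp;
  susp_bij : forall X Y : addcat, bijective (@fmap _ _ susp X Y)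
}.

Arguments susp {s}.
Arguments desusp {s} X.

Record stableAbelianCat := StableAbelianCat {
  stcat :> stableCat;
  stcat_abelian : abelian stcat
}.

(* A functor commutes with suspensions up to a specified natural isomorphism,
   not on the nose. *)
Record stableFunctor (C D : stableCat) := StableFunctor {
  sfun :> functor C D;
  sfun_susp : forall X : C, sfun (susp X) ~> susp (sfun X);
  sfun_susp_iso : forall X, is_iso (sfun_susp X);
  sfun_susp_nat : forall (X Y : C) (f : X ~> Y),
    sfun_susp Y ∘ fmap sfun (fmap susp f) =
    fmap susp (fmap sfun f) ∘ sfun_susp X
}.

Definition stable_nat_iso (C D : stableCat) (F G : stableFunctor C D) : Prop :=
  exists eta : forall X, F X ~> G X,
    [/\ forall X, is_iso (eta X),
        forall (X Y : C) (f : X ~> Y), eta Y ∘ fmap F f = fmap G f ∘ eta X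
      & forall X : C,
          sfun_susp G X ∘ eta (susp X) = fmap susp (eta X) ∘ sfun_susp F X].

Section FunctorComposition.

Lemma is_iso_comp (C : preadditiveCat) (X Y Z : C) (g : Y ~> Z) (f : X ~> Y) :
  is_iso g -> is_iso f -> is_iso (g ∘ f).
Proof.
move=> [g' [g'g gg']] [f' [f'f ff']]; exists (f' ∘ g'); split.
  by rewrite compA -(compA f') g'g compm1.
by rewrite compA -(compA g) ff' compm1.
Qed.

Lemma is_iso_fmap (C D : preadditiveCat) (F : functor C D) (X Y : C)
  (f : X ~> Y) : is_iso f -> is_iso (fmap F f).
Proof. by move=> [g [gf fg]]; exists (fmap F g); rewrite -!fmap_comp gf fg !fmap1. Qed.

Definition comp_functor (C D E : preadditiveCat)
  (G : functor D E) (F : functor C D) : functor C E.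
Proof.
exists (fun X => G (F X)) (fun X Y f => fmap G (fmap F f)).
- by move=> X; rewrite !fmap1.
- by move=> X Y Z g f; rewrite !fmap_comp.
- by move=> X Y f g; rewrite !fmap_additive.
Defined.

Definition comp_stable (C D E : stableCat)
  (G : stableFunctor D E) (F : stableFunctor C D) : stableFunctor C E.
Proof.
exists (comp_functor G F) (fun X => sfun_susp G (F X) ∘ fmap G (sfun_susp F X)).
- move=> X; apply: is_iso_comp; first exact: sfun_susp_iso.
  exact/is_iso_fmap/sfun_susp_iso.
- move=> X Y f /=.
  by rewrite -compA -fmap_comp sfun_susp_nat fmap_comp !compA sfun_susp_nat.
Defined.

End FunctorComposition.

Definition exact_functor (C D : stableAbelianCat) (F : functor C D) : Prop :=
  forall (X Y Z : C) (f : X ~> Y) (g : Y ~> Z),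
    exact_at f g -> exact_at (fmap F f) (fmap F g).

Record triangulatedCat := TriangulatedCat {
  tricat :> stableCat;
  exact_triangle : forall X Y Z : tricat,
    X ~> Y -> Y ~> Z -> Z ~> susp X -> Prop;
  tri_iso : forall (X Y Z X' Y' Z' : tricat)
    (u : X ~> Y) (v : Y ~> Z) (w : Z ~> susp X)
    (u' : X' ~> Y') (v' : Y' ~> Z') (w' : Z' ~> susp X')
    (f : X ~> X') (g : Y ~> Y') (h : Z ~> Z'),
    is_iso f -> is_iso g -> is_iso h ->
    g ∘ u = u' ∘ f -> h ∘ v = v' ∘ g -> fmap susp f ∘ w = w' ∘ h ->
    exact_triangle u v w -> exact_triangle u' v' w';
  tri_id : forall X Z : tricat, zero_object Z ->
    exact_triangle (idm X) (0 : X ~> Z) (0 : Z ~> susp X);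
  tri_cone : forall (X Y : tricat) (u : X ~> Y),
    exists (Z : tricat) (v : Y ~> Z) (w : Z ~> susp X), exact_triangle u v w;
  tri_rot : forall (X Y Z : tricat)
    (u : X ~> Y) (v : Y ~> Z) (w : Z ~> susp X),
    exact_triangle u v w <-> exact_triangle v w (- fmap susp u);
  tri_mor : forall (X Y Z X' Y' Z' : tricat)
    (u : X ~> Y) (v : Y ~> Z) (w : Z ~> susp X)
    (u' : X' ~> Y') (v' : Y' ~> Z') (w' : Z' ~> susp X')
    (f : X ~> X') (g : Y ~> Y'),
    exact_triangle u v w -> exact_triangle u' v' w' -> g ∘ u = u' ∘ f ->
    exists h : Z ~> Z', h ∘ v = v' ∘ g /\ fmap susp f ∘ w = w' ∘ h;
  (* octahedral axiom *)
  tri_oct : forall (X Y Z X' Y' Z' : tricat)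
    (u : X ~> Y) (j : Y ~> Z') (k : Z' ~> susp X)
    (v : Y ~> Z) (l : Z ~> X') (i : X' ~> susp Y)
    (m : Z ~> Y') (n : Y' ~> susp X),
    exact_triangle u j k -> exact_triangle v l i ->
    exact_triangle (v ∘ u) m n ->
    exists (f : Z' ~> Y') (g : Y' ~> X'),
      exact_triangle f g (fmap susp j ∘ i) /\
      [/\ f ∘ j = m ∘ v, n ∘ f = k, g ∘ m = l & i ∘ g = fmap susp u ∘ n]
}.

Definition homological (T : triangulatedCat) (D : stableAbelianCat)
    (H : functor T D) : Prop :=
  forall (X Y Z : T) (u : X ~> Y) (v : Y ~> Z) (w : Z ~> susp X),
    exact_triangle u v w -> exact_at (fmap H u) (fmap H v).

Definition has_countable_sums (C : preadditiveCat) : Prop :=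
  forall X : nat -> C, exists S (i : forall n, X n ~> S), is_coproduct i.

Section Ideals.
Variable T : triangulatedCat.

Definition morphism_class := forall X Y : T, X ~> Y -> Prop.

Implicit Type I : morphism_class.

Definition stable_homological_ideal I : Prop :=
  exists (D : stableAbelianCat) (H : stableFunctor T D),
    homological H /\ forall (X Y : T) (f : X ~> Y), I X Y f <-> fmap H f = 0.

Definition compatible_with_countable_sums I : Prop :=
  forall (X : nat -> T) (S : T) (i : forall n, X n ~> S), is_coproduct i ->
    forall (Y : T) (g : S ~> Y), I S Y g <-> forall n, I (X n) Y (g ∘ i n).

Definition I_projective I (P : T) : Prop :=
  forall (Y : T) (f : P ~> Y), I P Y f -> f = 0.

Definition I_epic I (X Y : T) (f : X ~> Y) : Prop :=
  exists (Z : T) (v : Y ~> Z) (w : Z ~> susp X),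
    exact_triangle f v w /\ I Y Z v.

Definition enough_projectives I : Prop :=
  forall X : T, exists (P : T) (f : P ~> X), I_projective I P /\ I_epic I f.

Definition I_contractible I (X : T) : Prop := I X X (idm X).

Definition I_exact I (D : stableAbelianCat) (F : functor T D) : Prop :=
  forall (X Y : T) (f : X ~> Y), I X Y f -> fmap F f = 0.

(* The factorization [H \o F ~ G] is one of stable functors, i.e. compatible with
   the suspension isomorphisms; uniqueness is up to plain natural isomorphism. *)
Definition universal_I_exact I (D : stableAbelianCat)
    (F : stableFunctor T D) : Prop :=
  [/\ homological F, I_exact I F &
      forall (E : stableAbelianCat) (G : stableFunctor T E),
        homological G -> I_exact I G ->
        (exists H : stableFunctor D E,
           exact_functor H /\ stable_nat_iso (comp_stable H F) G) /\
        (forall H H' : stableFunctor D E,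
           exact_functor H -> exact_functor H' ->
           stable_nat_iso (comp_stable H F) G ->
           stable_nat_iso (comp_stable H' F) G -> nat_iso H H')].

End Ideals.

(* The set of classes of [R], each class being given as a predicate. *)
Definition classes_of (X : Type) (R : X -> X -> Prop) : Type :=
  {c : X -> Prop | exists x, c = R x}.

Record projective_resolution (D : stableAbelianCat) (A : D) :=
  ProjectiveResolution {
  res :> nat -> D;
  res_d : forall n, res n.+1 ~> res n;
  res_aug : res 0 ~> A;
  res_projective : forall n, projective (res n);
  res_exact : forall n, exact_at (res_d n.+1) (res_d n);
  res_exact0 : exact_at (res_d 0) res_aug;
  res_aug_epi : epi res_aug
}.

(* A resolution 0 -> P_n -> ... -> P_0 -> A -> 0 is one indexed by all natural
   numbers that is zero beyond n. *)
Definition cohomological_dimension (D : stableAbelianCat) (A : D) (n : nat) :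
    Prop :=
  exists P : projective_resolution A, forall k, (n < k)%N -> zero_object (P k).

Section Ext.
Variables (D : stableAbelianCat) (A : D) (P : projective_resolution A) (B : D).

Definition cocycle n := {f : P n ~> B | f ∘ res_d P n = 0}.

Definition coboundary n : P n ~> B -> Prop :=
  match n with
  | 0 => fun f => f = 0
  | m.+1 => fun f => exists h : P m ~> B, f = h ∘ res_d P m
  end.

(* Underlying set of Ext^n(A, B), the n-th cohomology of Hom(P, B).  Resolutions
   are not chosen: Ext is a function of the resolution [P] of [A]. *)
Definition Ext n : Type :=
  classes_of (fun f g : cocycle n => coboundary (sval g - sval f)).

End Ext.

Section Liftings.
Variables (T : triangulatedCat) (I : morphism_class T).
Variables (D : stableAbelianCat) (F : stableFunctor T D) (A : D).

Record lifting := Lifting {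
  lift_obj : T;
  lift_orth : forall B : T, I_contractible I B ->
    forall f : lift_obj ~> B, f = 0;
  lift_map : F lift_obj ~> A;
  lift_map_iso : is_iso lift_map
}.

Definition lifting_equiv (L1 L2 : lifting) : Prop :=
  exists phi : lift_obj L1 ~> lift_obj L2,
    is_iso phi /\ lift_map L1 = lift_map L2 ∘ fmap F phi.

End Liftings.

(* Main.v *)
From HB Require Import structures.
From mathcomp Require Import all_boot all_algebra.
From mathcomp Require Import boolp.
Require Import Defs.

(** The ideal is the kernel of [F], because the functor that defines it factors
    through [F].  Call an object of [T] projective if it is so with respect to
    this ideal.  Three facts about [F] carry the classification: it is faithful
    and full on morphisms out of projective objects ([I_projective_inj],
    [universal_full]), it maps projective objects to projective objects
    ([universal_projective]), and every projective object of the target is, up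
    to isomorphism, the image of a projective object ([universal_realize]).

    These facts are extracted from the universal property by means of an
    auxiliary category [presented_cat].  Its objects are the objects [X] of the
    target together with a presentation [F P ~> X], [P] projective; its morphisms
    are the morphisms of the target that lift to the presentations.  It is
    Abelian, its inclusion into the target is exact and reflects exactness, and
    [F] factors through it because there are enough projective objects.  So the
    universal property provides an exact functor [R] in the other direction, and
    its uniqueness part says that [R] followed by the inclusion is isomorphic to
    the identity.  Hence every object of the target has a presentation, and every
    morphism [F P ~> F B] is, up to natural isomorphism, one that lifts; for
    projective [P] this means that it comes from [T].  A projective object of the
    target is then a retract of some [F P], and the corresponding idempotent on
    [P] splits by a swindle with a countable sum of copies of [P].

    For the classification, compare the given resolution with one of length 2:
    the second syzygy is projective.  So [A] has a resolution of the form
    [F R2 ~> F R1 ~> F R0 ~> A] induced by morphisms [d1] and [d0] of [T] with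
    [d0 ∘ d1 = 0].  Let [j : R1 ~> M] be the cone of [d1], with connecting
    morphism [k : M ~> susp R2].  Then [F M] is the kernel of [F R0 ~> A], and
    the cone of any [g : M ~> R0] with [g ∘ j = d0] is a lifting of [A].
    Conversely every lifting arises in this way: cover it by [R0], cover the
    fiber by [R1], and the next fiber is [R2].  After a choice of one such
    morphism [g0], all others are [g0 + x ∘ k] with [x : susp R2 ~> R0].  The
    equivalence class of the lifting determines and is determined by the image of
    [x] in [Hom(F (susp R2), A)] up to morphisms that factor through
    [F (susp R1)] ([coded_equiv]), and these classes form [Ext^2(A, A[-1])]. *)

Set Implicit Arguments.
Unset Strict Implicit.
Unset Printing Implicit Defensive.

Import GRing.Theory.
Local Open Scope ring_scope.
Local Open Scope cat_scope.

(** * Additive calculus *)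

Section Preadditive.
Variable C : preadditiveCat.
Implicit Types X Y Z : C.

Lemma comp0m X Y Z (f : X ~> Y) : (0 : Y ~> Z) ∘ f = 0.
Proof. by apply: (addIr ((0 : Y ~> Z) ∘ f)); rewrite -compDl addr0 add0r. Qed.

Lemma compm0 X Y Z (g : Y ~> Z) : g ∘ (0 : X ~> Y) = 0.
Proof. by apply: (addIr (g ∘ (0 : X ~> Y))); rewrite -compDr addr0 add0r. Qed.

Lemma compNm X Y Z (g : Y ~> Z) (f : X ~> Y) : (- g) ∘ f = - (g ∘ f).
Proof. by apply: (addIr (g ∘ f)); rewrite -compDl !addNr comp0m. Qed.

Lemma compmN X Y Z (g : Y ~> Z) (f : X ~> Y) : g ∘ (- f) = - (g ∘ f).
Proof. by apply: (addIr (g ∘ f)); rewrite -compDr !addNr compm0. Qed.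

Lemma compBl X Y Z (g g' : Y ~> Z) (f : X ~> Y) :
  (g - g') ∘ f = g ∘ f - g' ∘ f.
Proof. by rewrite compDl compNm. Qed.

Lemma compBr X Y Z (g : Y ~> Z) (f f' : X ~> Y) :
  g ∘ (f - f') = g ∘ f - g ∘ f'.
Proof. by rewrite compDr compmN. Qed.

Lemma monoP X Y (f : X ~> Y) :
  mono f <-> forall W (g : W ~> X), f ∘ g = 0 -> g = 0.
Proof.
split=> [mf W g fg0 | f0 W g h fgh]; first by apply: mf; rewrite compm0.
by apply/subr0_eq/f0; rewrite compBr fgh subrr.
Qed.

Lemma epiP X Y (f : X ~> Y) :
  epi f <-> forall Z (g : Y ~> Z), g ∘ f = 0 -> g = 0.
Proof.
split=> [ef W g gf0 | f0 W g h gfh]; first by apply: ef; rewrite comp0m.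
by apply/subr0_eq/f0; rewrite compBl gfh subrr.
Qed.

Lemma mono0 X Y (f : X ~> Y) W (g : W ~> X) : mono f -> f ∘ g = 0 -> g = 0.
Proof. by move=> /monoP; apply. Qed.

Lemma epi0 X Y (f : X ~> Y) Z (g : Y ~> Z) : epi f -> g ∘ f = 0 -> g = 0.
Proof. by move=> /epiP; apply. Qed.

Lemma mono_comp X Y Z (g : Y ~> Z) (f : X ~> Y) :
  mono g -> mono f -> mono (g ∘ f).
Proof. by move=> mg mf W a b; rewrite -!compA => /mg/mf. Qed.

Lemma epi_comp X Y Z (g : Y ~> Z) (f : X ~> Y) :
  epi g -> epi f -> epi (g ∘ f).
Proof. by move=> eg ef W a b; rewrite !compA => /ef/eg. Qed.

Lemma epi_compl X Y Z (g : Y ~> Z) (f : X ~> Y) : epi (g ∘ f) -> epi g.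
Proof. by move=> e W a b ab; apply: e; rewrite !compA ab. Qed.

Lemma is_iso_mono X Y (f : X ~> Y) : is_iso f -> mono f.
Proof.
move=> [g [gf _]] W a b fab.
by rewrite -(comp1m a) -(comp1m b) -gf -!compA fab.
Qed.

Lemma is_iso_epi X Y (f : X ~> Y) : is_iso f -> epi f.
Proof.
move=> [g [_ fg]] W a b fab.
by rewrite -(compm1 a) -(compm1 b) -fg !compA fab.
Qed.

Lemma is_iso_id X : is_iso (idm X).
Proof. by exists (idm X); rewrite comp1m. Qed.

Lemma zero_object_id X : idm X = 0 -> zero_object X.
Proof.
move=> X0; split=> Y f g.
  by rewrite -(comp1m f) -(comp1m g) X0 !comp0m.
by rewrite -(compm1 f) -(compm1 g) X0 !compm0.
Qed.

Lemma kernel_mono X Y K (f : X ~> Y) (k : K ~> X) : is_kernel f k -> mono k.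
Proof.
move=> [fk0 kP] W a b kab.
have [|h [_ hU]] := kP W (k ∘ a); first by rewrite compA fk0 comp0m.
by rewrite -(hU a) // -(hU b).
Qed.

Lemma cokernel_epi X Y Q (f : X ~> Y) (q : Y ~> Q) : is_cokernel f q -> epi q.
Proof.
move=> [qf0 qP] W a b qab.
have [|h [_ hU]] := qP W (a ∘ q); first by rewrite -compA qf0 compm0.
by rewrite -(hU a) // -(hU b).
Qed.

Lemma kernel_factor X Y K (f : X ~> Y) (k : K ~> X) W (g : W ~> X) :
  is_kernel f k -> f ∘ g = 0 -> exists h : W ~> K, k ∘ h = g.
Proof. by move=> [_ kP] /kP[h [kh _]]; exists h. Qed.

Lemma cokernel_factor X Y Q (f : X ~> Y) (q : Y ~> Q) W (g : Y ~> W) :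
  is_cokernel f q -> g ∘ f = 0 -> exists h : Q ~> W, h ∘ q = g.
Proof. by move=> [_ kP] /kP[h [kh _]]; exists h. Qed.

Lemma is_kernelI X Y K (f : X ~> Y) (k : K ~> X) : mono k -> f ∘ k = 0 ->
  (forall W (g : W ~> X), f ∘ g = 0 -> exists h : W ~> K, k ∘ h = g) ->
  is_kernel f k.
Proof.
move=> mk fk0 kP; split=> // W g /kP[h kh]; exists h; split=> // h' kh'.
by apply: mk; rewrite kh kh'.
Qed.

Lemma is_cokernelI X Y Q (f : X ~> Y) (q : Y ~> Q) : epi q -> q ∘ f = 0 ->
  (forall W (g : Y ~> W), g ∘ f = 0 -> exists h : Q ~> W, h ∘ q = g) ->
  is_cokernel f q.
Proof.
move=> mk fk0 kP; split=> // W g /kP[h kh]; exists h; split=> // h' kh'.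
by apply: mk; rewrite kh kh'.
Qed.

Lemma kernel_iso X Y K K' (f : X ~> Y) (k : K ~> X) (k' : K' ~> X)
    (h : K' ~> K) :
  is_kernel f k -> is_iso h -> k ∘ h = k' -> is_kernel f k'.
Proof.
move=> kK hh <-; have [h' [h'h hh']] := hh.
apply: is_kernelI.
- by apply: mono_comp; [exact: kernel_mono kK | exact: is_iso_mono].
- by rewrite compA (proj1 kK) comp0m.
move=> W g /(kernel_factor kK)[t <-]; exists (h' ∘ t).
by rewrite -compA (compA h) hh' comp1m.
Qed.

Lemma cokernel_iso X Y Q Q' (f : X ~> Y) (q : Y ~> Q) (q' : Y ~> Q')
    (h : Q ~> Q') :
  is_cokernel f q -> is_iso h -> h ∘ q = q' -> is_cokernel f q'.
Proof.
move=> qQ hh <-; have [h' [h'h hh']] := hh.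
apply: is_cokernelI.
- by apply: epi_comp; [exact: is_iso_epi | exact: cokernel_epi qQ].
- by rewrite -compA (proj1 qQ) compm0.
move=> W g /(cokernel_factor qQ)[t <-]; exists (t ∘ h').
by rewrite compA -(compA t) h'h compm1.
Qed.

Lemma kernel_unique X Y K K' (f : X ~> Y) (k : K ~> X) (k' : K' ~> X) :
  is_kernel f k -> is_kernel f k' -> exists h : K' ~> K, is_iso h /\ k ∘ h = k'.
Proof.
move=> kK kK'.
have [h kh] := kernel_factor kK (proj1 kK').
have [h' kh'] := kernel_factor kK' (proj1 kK).
exists h; split=> //; exists h'; split.
  by apply: (kernel_mono kK'); rewrite compA kh' kh compm1.
by apply: (kernel_mono kK); rewrite compA kh kh' compm1.
Qed.

Lemma cokernel_unique X Y Q Q' (f : X ~> Y) (q : Y ~> Q) (q' : Y ~> Q') :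
  is_cokernel f q -> is_cokernel f q' ->
  exists h : Q ~> Q', is_iso h /\ h ∘ q = q'.
Proof.
move=> qQ qQ'.
have [h hq] := cokernel_factor qQ (proj1 qQ').
have [h' hq'] := cokernel_factor qQ' (proj1 qQ).
exists h; split=> //; exists h'; split.
  by apply: (cokernel_epi qQ); rewrite -compA hq hq' comp1m.
by apply: (cokernel_epi qQ'); rewrite -compA hq' hq comp1m.
Qed.

Lemma mono_isol X Y Z (g : Y ~> Z) (f : X ~> Y) :
  is_iso g -> (mono (g ∘ f) <-> mono f).
Proof.
move=> ig; split=> mf; last exact: mono_comp (is_iso_mono ig) mf.
by move=> W a b fab; apply: mf; rewrite -!compA fab.
Qed.

Lemma mono_isor X Y Z (g : Y ~> Z) (f : X ~> Y) :
  is_iso f -> (mono (g ∘ f) <-> mono g).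
Proof.
move=> fi; split=> mg; last exact: mono_comp mg (is_iso_mono fi).
have [f' [f'f ff']] := fi; move=> W a b gab.
apply: (is_iso_mono (f := f')); first by exists f.
by apply: mg; rewrite -!compA !(compA f) ff' !comp1m.
Qed.

End Preadditive.

Section AdditiveFunctor.
Variables (C D : preadditiveCat) (F : functor C D).

Lemma fmapB (X Y : C) (f g : X ~> Y) : fmap F (f - g) = fmap F f - fmap F g.
Proof. exact: fmap_additive. Qed.

Lemma fmap0 (X Y : C) : fmap F (0 : X ~> Y) = 0.
Proof. by rewrite -(subrr (0 : X ~> Y)) fmapB subrr. Qed.

Lemma fmapN (X Y : C) (f : X ~> Y) : fmap F (- f) = - fmap F f.
Proof. by rewrite -sub0r fmapB fmap0 sub0r. Qed.

Lemma fmapD (X Y : C) (f g : X ~> Y) : fmap F (f + g) = fmap F f + fmap F g.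
Proof. by rewrite -{1}(opprK g) fmapB fmapN opprK. Qed.

End AdditiveFunctor.

(** * Abelian categories *)

Section Abelian.
Variables (C : additiveCat) (abC : abelian C).
Implicit Types X Y Z : C.

Lemma has_kernel X Y (f : X ~> Y) : exists K (k : K ~> X), is_kernel f k.
Proof. by have [+ _ _ _] := abC; apply. Qed.

Lemma has_cokernel X Y (f : X ~> Y) : exists Q (q : Y ~> Q), is_cokernel f q.
Proof. by have [_ + _ _] := abC; apply. Qed.

(** An epimorphism is the cokernel of its kernel; this form speaks of the
    generalized elements that it kills. *)
Lemma epi_factor X Y Z (e : X ~> Y) (g : X ~> Z) : epi e ->
  (forall W (x : W ~> X), e ∘ x = 0 -> g ∘ x = 0) ->
  exists h : Y ~> Z, h ∘ e = g.
Proof.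
move=> ee gP; have [_ _ _ /(_ _ _ e ee)[W [w cokw]]] := abC.
by apply: (cokernel_factor cokw); apply: gP; apply: (proj1 cokw).
Qed.

Lemma mono_epi_iso X Y (f : X ~> Y) : mono f -> epi f -> is_iso f.
Proof.
move=> mf ef; have [_ _ /(_ _ _ f mf)[Z [g kf]] _] := abC.
have g0 : g = 0 by apply: epi0 ef (proj1 kf).
have [|h fh] := kernel_factor (g := idm Y) kf; first by rewrite g0 comp0m.
exists h; split=> //; apply: mf; by rewrite compA fh comp1m compm1.
Qed.

(** The kernel of [Y (+) X ~> Z], projected to [X]. *)
Lemma epi_pullback X Y Z (e : Y ~> Z) (f : X ~> Z) : epi e ->
  exists W (e' : W ~> X) (f' : W ~> Y), epi e' /\ e ∘ f' = f ∘ e'.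
Proof.
move=> ee; have [S [i1 [i2 [p1 [p2 [pi11 pi22 pi12 pi21 S1]]]]]] :=
  has_biproducts Y X.
have [W [k kk]] := has_kernel (e ∘ p1 - f ∘ p2).
exists W, (p2 ∘ k), (p1 ∘ k); split; last first.
  by apply/eqP; rewrite -subr_eq0 !compA -compBl (proj1 kk).
apply/epiP => V h hk0.
have d1 : (e ∘ p1 - f ∘ p2) ∘ i1 = e.
  by rewrite compBl -!compA pi11 pi21 compm1 compm0 subr0.
(* A morphism [h] that kills [p2 ∘ k] yields [h ∘ p2] on the biproduct, which
   factors through [Z] by a morphism that vanishes on the image of [e]. *)
have ed : epi (e ∘ p1 - f ∘ p2).
  by apply: (@epi_compl _ _ _ _ _ i1); rewrite d1.
have [||t tE] := @epi_factor _ _ _ (e ∘ p1 - f ∘ p2) (h ∘ p2) => //.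
  by move=> U x /(kernel_factor kk)[y <-]; rewrite compA -(compA h) hk0 comp0m.
have t0 : t = 0.
  by apply: (epi0 ee); rewrite -d1 compA tE -compA pi21 compm0.
by rewrite -(compm1 h) -pi22 compA -tE t0 !comp0m.
Qed.

(** If the corestriction of [f] to its image factored through a smaller
    subobject of [Y], that subobject would be a kernel of a morphism that kills
    [f], hence would contain the image. *)
Lemma image_factor X Y J (f : X ~> Y) (m : J ~> Y) : is_image f m ->
  exists f' : X ~> J, epi f' /\ m ∘ f' = f.
Proof.
move=> [Q [q [cq km]]]; have [f' mf'] := kernel_factor km (proj1 cq).
exists f'; split=> //; apply/epiP => Z h hf0.
have [K [k kk]] := has_kernel h; have [f'' kf''] := kernel_factor kk hf0.
have [_ _ /(_ _ _ (m ∘ k))/(_ (mono_comp (kernel_mono km) (kernel_mono kk)))] :=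
  abC; move=> [V [c kc]] _.
have [|c' c'q] := cokernel_factor (g := c) cq.
  by rewrite -mf' -kf'' !compA -(compA c) (proj1 kc) comp0m.
have [|t mkt] := kernel_factor (g := m) kc.
  by rewrite -c'q -compA (proj1 km) compm0.
have kt : k ∘ t = idm J.
  by apply: (kernel_mono km); rewrite compA mkt compm1.
by rewrite -(compm1 h) -kt compA (proj1 kk) comp0m.
Qed.

(** Diagram chases run on generalized elements, which may be replaced by their
    composites with epimorphisms. *)
Lemma exact_lift X Y Z (f : X ~> Y) (g : Y ~> Z) W (y : W ~> Y) :
  exact_at f g -> g ∘ y = 0 ->
  exists V (e : V ~> W) (x : V ~> X), epi e /\ f ∘ x = y ∘ e.
Proof.
move=> [J [m [im km]]] gy0; have [f' [ef' mf']] := image_factor im.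
have [y' my'] := kernel_factor km gy0.
have [V [e [x [ee xe]]]] := epi_pullback y' ef'.
by exists V, e, x; split=> //; rewrite -mf' -compA xe compA my'.
Qed.

Lemma exact_comp0 X Y Z (f : X ~> Y) (g : Y ~> Z) : exact_at f g -> g ∘ f = 0.
Proof.
move=> [J [m [[Q [q [cq km']]] km]]].
have [h <-] := kernel_factor km' (proj1 cq).
by rewrite compA (proj1 km) comp0m.
Qed.

Lemma projective_lift X Y Z B (f : X ~> Y) (g : Y ~> Z) (y : B ~> Y) :
  projective B -> exact_at f g -> g ∘ y = 0 -> exists x : B ~> X, f ∘ x = y.
Proof.
move=> pB [J [m [im km]]] gy0; have [f' [ef' mf']] := image_factor im.
have [y' my'] := kernel_factor km gy0.
have [x xE] := pB _ _ f' y' ef'.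
by exists x; rewrite -mf' -compA xE.
Qed.

End Abelian.

(** * Triangulated categories *)

Section Suspension.
Variable C : stableCat.
Implicit Types X Y Z : C.

Lemma susp_inj X Y (f g : X ~> Y) : fmap susp f = fmap susp g -> f = g.
Proof. exact: bij_inj (susp_bij X Y) _ _. Qed.

Lemma susp_surj X Y (g : susp X ~> susp Y) : exists f, fmap susp f = g.
Proof. by have [h _ hK] := susp_bij X Y; exists (h g). Qed.

Lemma susp_obj Y : exists X, Y = susp X.
Proof. by exists (desusp Y); rewrite desuspK. Qed.

Lemma susp_mono X Y (f : X ~> Y) : mono (fmap susp f) <-> mono f.
Proof.
split=> /monoP mf; apply/monoP.
  move=> W g fg0; apply: susp_inj; rewrite fmap0; apply: mf.
  by rewrite -fmap_comp fg0 fmap0.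
move=> W; have [V ->] := susp_obj W => g.
have [h <-] := susp_surj g; rewrite -fmap_comp => fh0.
by rewrite (mf _ h) ?fmap0 //; apply: susp_inj; rewrite fh0 fmap0.
Qed.

Lemma susp_epi X Y (f : X ~> Y) : epi f -> epi (fmap susp f).
Proof.
move=> /epiP ef; apply/epiP => W; have [V ->] := susp_obj W => g.
have [h <-] := susp_surj g; rewrite -fmap_comp => fh0.
by rewrite (ef _ h) ?fmap0 //; apply: susp_inj; rewrite fh0 fmap0.
Qed.

Lemma susp_zero_object X : zero_object X -> zero_object (susp X).
Proof.
move=> [X0 _]; apply: zero_object_id.
by rewrite -fmap1 (X0 _ (idm X) 0) fmap0.
Qed.

End Suspension.

Section Triangulated.
Variable T : triangulatedCat.
Implicit Types X Y Z : T.

Section Triangle.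
Variables (X Y Z : T) (u : X ~> Y) (v : Y ~> Z) (w : Z ~> susp X).
Hypothesis uvw : exact_triangle u v w.

Lemma tri_comp0 : v ∘ u = 0.
Proof.
have [O O0] := has_zero_object T.
have [|h [hE _]] := tri_mor (f := idm X) (g := u) (tri_id X O0) uvw => //.
by rewrite -hE compm0.
Qed.

Lemma tri_rotate : exact_triangle v w (- fmap susp u).
Proof. exact: (proj1 (tri_rot u v w) uvw). Qed.

Lemma tri_lift P (g : P ~> Y) : v ∘ g = 0 -> exists h : P ~> X, u ∘ h = g.
Proof.
move=> vg0; have [O O0] := has_zero_object T.
(* Map the triangle [P ~> O ~> susp P] to the rotated one and desuspend. *)
have P0 := (tri_rot _ _ _).1 (tri_id P O0).
have [|h [_]] := tri_mor (f := g) (g := 0 : O ~> Z) P0 tri_rotate.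
  by rewrite vg0 compm0.
have [h' <-] := susp_surj h.
rewrite fmap1 compmN compm1 compNm => /oppr_inj; rewrite -fmap_comp => e.
by exists h'; apply: susp_inj.
Qed.

Lemma tri_extend Q (g : Y ~> Q) : g ∘ u = 0 -> exists h : Z ~> Q, h ∘ v = g.
Proof.
move=> gu0; have [O O0] := has_zero_object T.
have Q0 : exact_triangle (0 : O ~> Q) (idm Q) (0 : Q ~> susp O).
  apply/tri_rot; rewrite fmap0 oppr0; exact: tri_id (susp_zero_object O0).
have [|h [hE _]] := tri_mor (f := 0 : X ~> O) (g := g) uvw Q0.
  by rewrite gu0 compm0.
by exists h; rewrite hE comp1m.
Qed.

End Triangle.

Lemma tri_fiber Y Z (v : Y ~> Z) :
  exists X (u : X ~> Y) (w : Z ~> susp X), exact_triangle u v w.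
Proof.
have [C [w [t]]] := tri_cone v; have [X eX] := susp_obj C.
move: w t; rewrite eX => w t.
have [u <-] := susp_surj t; rewrite -(opprK u) fmapN => vwu.
by exists X, (- u), w; apply/tri_rot.
Qed.

(** On the sum of countably many copies of [X], the endomorphism [g] shifts the
    copies of the image of [e] down by one and fixes those of the image of
    [1 - e].  It is a split epimorphism, so its fiber is a direct summand of the
    sum: it is the image of [e] in the bottom copy, and thereby splits [e]. *)
Lemma idempotent_split (hT : has_countable_sums T) X (e : X ~> X) :
  e ∘ e = e ->
  exists W (a : W ~> X) (b : X ~> W), a ∘ b = e /\ b ∘ a = idm W.
Proof.
move=> ee; pose e' := idm X - e.
have e'e : e' ∘ e = 0 by rewrite compBl comp1m ee subrr.
have ee' : e ∘ e' = 0 by rewrite compBr compm1 ee subrr.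
have e'e' : e' ∘ e' = e' by rewrite {1}/e' compBl comp1m ee' subr0.
have eDe' : e + e' = idm X by rewrite addrC subrK.
have [S [i Si]] := hT (fun=> X).
have S_eq Y (f g : S ~> Y) : (forall n, f ∘ i n = g ∘ i n) -> f = g.
  move=> fg; have [h [_ hU]] := Si Y (fun n => g ∘ i n).
  by rewrite -(hU f) // -(hU g).
have [p [pi _]] := Si X (fun n => if n is 0%N then idm X else 0).
have [g [gi _]] := Si S
  (fun n => if n is m.+1 then i m ∘ e + i n ∘ e' else i 0%N ∘ e').
have [s [si _]] := Si S (fun n => i n.+1 ∘ e + i n ∘ e').
have gs : g ∘ s = idm S.
  apply: S_eq => n; rewrite -compA si comp1m compDr !compA !gi.
  rewrite compDl -!compA ee e'e compm0 addr0.
  case: n => [|n]; first by rewrite -compA e'e' -compDr eDe' compm1.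
  by rewrite compDl -!compA ee' e'e' compm0 add0r -compDr eDe' compm1.
have sg : idm S - s ∘ g = i 0%N ∘ e ∘ p.
  apply: S_eq => n; rewrite compBl comp1m -!compA gi pi.
  case: n => [|n] /=.
    rewrite compm1 !compA si compDl -!compA ee' e'e' compm0 add0r.
    by rewrite -[X in X - _]compm1 -eDe' compDr addrK.
  rewrite !compm0 compDr !compA !si !compDl -!compA ee ee' e'e e'e' !compm0.
  rewrite addr0 add0r -compDr eDe'.
  by rewrite compm1 subrr.
have [W [k [w kgw]]] := tri_fiber g.
have gk := tri_comp0 kgw.
have w0 : w = 0.
  by rewrite -(compm1 w) -gs compA (tri_comp0 (tri_rotate kgw)) comp0m.
have k_mono : mono k.
  apply/susp_mono/monoP => V y ky.
  have [|z <-] := tri_lift (tri_rotate (tri_rotate kgw)) (g := y).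
    by rewrite compNm ky oppr0.
  by rewrite w0 comp0m.
have [|r kr] := tri_lift kgw (g := idm S - s ∘ g).
  by rewrite compBr compm1 compA gs comp1m subrr.
have rk : r ∘ k = idm W.
  by apply: k_mono; rewrite compA kr compBl comp1m -compA gk compm0 subr0 compm1.
have pi0 : p ∘ i 0%N = idm X by rewrite pi.
exists W, (e ∘ p ∘ k), (r ∘ i 0%N); split.
  rewrite -!compA (compA k) kr sg (compA p) (compA p) (compA p) pi0 comp1m.
  by rewrite -compA pi0 compm1.
rewrite compA; move: (sg); rewrite -kr => kr'.
by rewrite -!compA (compA (i 0%N)) (compA (i 0%N ∘ e)) -kr' !compA rk comp1m rk.
Qed.

End Triangulated.

(** * Homological functors and their kernels *)

Section Homological.
Variables (T : triangulatedCat) (D : stableAbelianCat) (F : stableFunctor T D).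
Hypothesis homF : homological F.
Implicit Types X Y Z P Q : T.

Let abD : abelian D := stcat_abelian D.

Definition ker_ideal : morphism_class T := fun X Y f => fmap F f = 0.

Lemma susp_conj X Y (f : X ~> Y) (s' : susp (F Y) ~> F (susp Y)) :
  s' ∘ sfun_susp F Y = idm (F (susp Y)) ->
  fmap F (fmap susp f) = s' ∘ fmap susp (fmap F f) ∘ sfun_susp F X.
Proof. by move=> s's; rewrite -compA -sfun_susp_nat compA s's comp1m. Qed.

Lemma ker_susp X Y (f : X ~> Y) :
  fmap F (fmap susp f) = 0 <-> fmap F f = 0.
Proof.
have [s [_ ss]] := sfun_susp_iso F X; have [s' [s's _]] := sfun_susp_iso F Y.
split=> f0; last by rewrite (susp_conj f s's) f0 fmap0 compm0 comp0m.
apply: susp_inj; rewrite fmap0; apply: epi0 (is_iso_epi (sfun_susp_iso F X)) _.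
by rewrite -sfun_susp_nat f0 compm0.
Qed.

Lemma fmap_susp_mono X Y (f : X ~> Y) :
  mono (fmap F (fmap susp f)) <-> mono (fmap F f).
Proof.
rewrite -(mono_isol (fmap F (fmap susp f)) (sfun_susp_iso F Y)) sfun_susp_nat.
by rewrite (mono_isor _ (sfun_susp_iso F X)) susp_mono.
Qed.

Lemma hom_lift X Y Z (u : X ~> Y) (v : Y ~> Z) (w : Z ~> susp X) W
    (y : W ~> F Y) : exact_triangle u v w -> fmap F v ∘ y = 0 ->
  exists V (e : V ~> W) (x : V ~> F X), epi e /\ fmap F u ∘ x = y ∘ e.
Proof. by move=> /homF ex; apply: exact_lift. Qed.

Lemma hom_epi X Y Z (u : X ~> Y) (v : Y ~> Z) (w : Z ~> susp X) :
  exact_triangle u v w -> fmap F v = 0 -> epi (fmap F u).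
Proof.
move=> uvw v0; have [|V [e [x [ee uxe]]]] := hom_lift (y := idm _) uvw.
  by rewrite v0 comp0m.
by apply: (@epi_compl _ _ _ _ _ x); rewrite uxe comp1m.
Qed.

Lemma hom_mono X Y Z (u : X ~> Y) (v : Y ~> Z) (w : Z ~> susp X) :
  exact_triangle u v w -> fmap F u = 0 -> mono (fmap F v).
Proof.
move=> uvw u0; apply/monoP => W y vy0.
have [V [e [x [ee]]]] := hom_lift uvw vy0.
by rewrite u0 comp0m => /esym; apply: epi0.
Qed.

(** Both sides say that the connecting morphism is killed by [F]. *)
Lemma triangle_mono_epi X Y Z (u : X ~> Y) (v : Y ~> Z) (w : Z ~> susp X) :
  exact_triangle u v w -> mono (fmap F u) <-> epi (fmap F v).
Proof.
move=> uvw; have vwu := tri_rotate uvw; have wuv := tri_rotate vwu.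
split=> [mu | ev].
  apply: (hom_epi vwu).
  apply: (mono0 ((fmap_susp_mono u).2 mu)); apply/oppr_inj.
  by rewrite oppr0 -compNm -fmapN -fmap_comp (tri_comp0 wuv) fmap0.
apply/fmap_susp_mono.
have w0 : fmap F w = 0.
  by apply: (epi0 ev); rewrite -fmap_comp (tri_comp0 vwu) fmap0.
apply/monoP => W y uy0; apply: (mono0 (hom_mono wuv w0)).
by rewrite fmapN compNm uy0 oppr0.
Qed.

(** * Projective objects of the kernel ideal *)

Lemma I_projective_susp P :
  I_projective ker_ideal P <-> I_projective ker_ideal (susp P).
Proof.
split=> pP Y.
  have [Y' ->] := susp_obj Y => f; have [f' <-] := susp_surj f.
  by move=> /ker_susp/pP ->; rewrite fmap0.
by move=> f /ker_susp/pP f0; apply: susp_inj; rewrite f0 fmap0.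
Qed.

Lemma I_projective_biproduct P Q S (i1 : P ~> S) (i2 : Q ~> S)
    (p1 : S ~> P) (p2 : S ~> Q) : is_biproduct i1 i2 p1 p2 ->
  I_projective ker_ideal P -> I_projective ker_ideal Q ->
  I_projective ker_ideal S.
Proof.
move=> [_ _ _ _ S1] pP pQ Y f f0; rewrite -(compm1 f) -S1 compDr !compA.
have -> : f ∘ i1 = 0 by apply: pP; rewrite /ker_ideal fmap_comp f0 comp0m.
have -> : f ∘ i2 = 0 by apply: pQ; rewrite /ker_ideal fmap_comp f0 comp0m.
by rewrite !comp0m addr0.
Qed.

Lemma I_projective_inj P Y (f g : P ~> Y) : I_projective ker_ideal P ->
  fmap F f = fmap F g -> f = g.
Proof. by move=> pP fg; apply/subr0_eq/pP; rewrite /ker_ideal fmapB fg subrr. Qed.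

Lemma I_epic_epi X Y (f : X ~> Y) : I_epic ker_ideal f -> epi (fmap F f).
Proof. by move=> [Z [v [w [fvw v0]]]]; apply: hom_epi fvw v0. Qed.

Lemma I_epic_lift P X Y (f : X ~> Y) (g : P ~> Y) :
  I_epic ker_ideal f -> I_projective ker_ideal P ->
  exists h : P ~> X, f ∘ h = g.
Proof.
move=> [Z [v [w [fvw v0]]]] pP; apply: (tri_lift fvw).
by apply: pP; rewrite /ker_ideal fmap_comp v0 comp0m.
Qed.

Lemma I_epic_lift_susp P X Y (f : X ~> Y) (g : P ~> susp Y) :
  I_epic ker_ideal f -> I_projective ker_ideal P ->
  exists h : P ~> susp X, fmap susp f ∘ h = g.
Proof.
move=> ef; move: g; have [Q ->] := susp_obj P => g sQ.
have pQ := (I_projective_susp Q).2 sQ; have [g' <-] := susp_surj g.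
have [h fh] := I_epic_lift g' ef pQ.
by exists (fmap susp h); rewrite -fmap_comp fh.
Qed.

(** * Objects without morphisms to contractible objects *)

Definition contractible_orth X : Prop :=
  forall B, I_contractible ker_ideal B -> forall f : X ~> B, f = 0.

Lemma I_projective_orth P : I_projective ker_ideal P -> contractible_orth P.
Proof.
move=> pP B B0 f; apply: pP.
by rewrite /ker_ideal -(comp1m f) fmap_comp B0 comp0m.
Qed.

Lemma contractible_susp X :
  I_contractible ker_ideal (susp X) <-> I_contractible ker_ideal X.
Proof. by rewrite /I_contractible /ker_ideal -fmap1; apply: ker_susp. Qed.

Lemma orth_susp X : contractible_orth X <-> contractible_orth (susp X).
Proof.
split=> oX B.
  have [B' ->] := susp_obj B => /contractible_susp B0 f.
  by have [f' <-] := susp_surj f; rewrite (oX _ B0 f') fmap0.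
by move=> /contractible_susp B0 f; apply: susp_inj; rewrite fmap0; apply: oX.
Qed.

Lemma orth_cone X Y Z (u : X ~> Y) (v : Y ~> Z) (w : Z ~> susp X) :
  exact_triangle u v w -> contractible_orth X -> contractible_orth Y ->
  contractible_orth Z.
Proof.
move=> uvw /orth_susp oX oY B B0 f.
have [|g <-] := tri_extend (tri_rotate uvw) (g := f); first exact: oY.
by rewrite (oX B B0 g) comp0m.
Qed.

Lemma orth_fiber X Y Z (u : X ~> Y) (v : Y ~> Z) (w : Z ~> susp X) :
  exact_triangle u v w -> contractible_orth Y -> contractible_orth Z ->
  contractible_orth X.
Proof.
by move=> uvw oY oZ; apply/orth_susp; apply: orth_cone (tri_rotate uvw) oY oZ.
Qed.

(** The cone of [f] is contractible, hence receives no nonzero morphism from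
    [X], [Y] or their suspensions. *)
Lemma orth_whitehead X Y (f : X ~> Y) : contractible_orth X ->
  contractible_orth Y -> is_iso (fmap F f) -> is_iso f.
Proof.
move=> oX oY iF; have [C [v [w fvw]]] := tri_cone f.
have vwf := tri_rotate fvw; have wfv := tri_rotate vwf.
have Fv0 : fmap F v = 0.
  by apply: epi0 (is_iso_epi iF) _; rewrite -fmap_comp (tri_comp0 fvw) fmap0.
have Fw : epi (fmap F v).
  by apply/(triangle_mono_epi fvw)/is_iso_mono.
have C0 : I_contractible ker_ideal C.
  by apply: (epi0 Fw); rewrite Fv0 compm0.
have v0 : v = 0 by apply: oY.
have [|g fg] := tri_lift fvw (g := idm Y); first by rewrite v0 comp0m.
exists g; split=> //; apply/subr0_eq/susp_inj; rewrite fmap0.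
have [|z <-] := tri_lift wfv (g := fmap susp (g ∘ f - idm X)).
  rewrite compNm -fmap_comp compBr compA fg comp1m compm1 subrr.
  by rewrite fmap0 oppr0.
by rewrite ((orth_susp X).1 oX C C0 z) compm0.
Qed.

End Homological.
Arguments ker_ideal {T D} F X Y _.

(** * Presentations by projective objects *)

Section Presented.
Variables (T : triangulatedCat) (D : stableAbelianCat) (F : stableFunctor T D).
Hypothesis homF : homological F.
Hypothesis enoughP : enough_projectives (ker_ideal F).
Local Notation proj := (I_projective (ker_ideal F)).

Let abD : abelian D := stcat_abelian D.

(** A projective cover of the fiber of [g]. *)
Lemma kernel_cover (P B : T) (g : P ~> B) :
  exists Q (a : Q ~> P), [/\ proj Q, g ∘ a = 0,
    forall R (w : R ~> P), proj R -> g ∘ w = 0 -> exists w', a ∘ w' = w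
  & forall W (y : W ~> F P), fmap F g ∘ y = 0 ->
    exists V (e : V ~> W) (x : V ~> F Q), epi e /\ fmap F a ∘ x = y ∘ e].
Proof.
have [N [n [w ngw]]] := tri_fiber g; have [Q [b [pQ eb]]] := enoughP N.
exists Q, (n ∘ b); split=> //.
- by rewrite compA (tri_comp0 ngw) comp0m.
- move=> R r pR /(tri_lift ngw)[r' <-].
  have [r'' <-] := I_epic_lift r' eb pR.
  by exists r''; rewrite compA.
move=> W y /(hom_lift homF ngw)[V [e [x [ee xe]]]].
have [V' [e' [x' [ee' xe']]]] := epi_pullback abD x (I_epic_epi homF eb).
exists V', (e ∘ e'), x'; split; first exact: epi_comp.
by rewrite fmap_comp -compA xe' compA xe compA.
Qed.

(** Such a [q] exhibits [X] as the image of [fmap F v].  A projective cover of the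
    fiber of [v] then maps onto the kernel of [q], so [X] is also the cokernel of
    [F] of a morphism between projective objects.  The image form makes it
    visible which morphisms into [P] are killed by [q]: those killed by [v], if
    their domain is projective. *)
Definition is_presentation (P : T) (X : D) (q : F P ~> X) : Prop :=
  [/\ proj P, epi q
    & exists C (v : P ~> C) (m : X ~> F C), mono m /\ m ∘ q = fmap F v].

Definition lifts (P P' : T) (X X' : D) (q : F P ~> X) (q' : F P' ~> X')
    (phi : X ~> X') : Prop :=
  exists u : P ~> P', phi ∘ q = q' ∘ fmap F u.

(** The kernel of [phi] is presented by a projective cover of the fiber of
    [v' ∘ u], where [u] lifts [phi] and [fmap F v'] has image [X']. *)
Lemma presentation_kernel (P P' : T) (X X' K : D) (q : F P ~> X)
    (q' : F P' ~> X') (phi : X ~> X') (k : K ~> X) :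
  is_presentation q -> is_presentation q' -> lifts q q' phi ->
  is_kernel phi k ->
  exists Q (r : F Q ~> K), [/\ is_presentation r, lifts r q k
    & forall (R : T) (Y : D) (s : F R ~> Y) (h : Y ~> K), is_presentation s ->
        lifts s q (k ∘ h) -> lifts s r h].
Proof.
move=> [pP eq [C [v [m [mm mq]]]]] [_ eq' [C' [v' [m' [mm' mq']]]]] [u uE] kk.
have [Q [a [pQ ga0 aP aF]]] := kernel_cover (v' ∘ u).
have [|r kr] := kernel_factor (g := q ∘ fmap F a) kk.
  apply: (mono0 mm').
  by rewrite !compA -(compA m' phi) uE compA mq' -!fmap_comp ga0 fmap0.
exists Q, r; split; last 1 first.
- move=> R Y s h [pR es _] [w wE].
  have [|w' aw'] := aP R w pR.
    apply: pR; rewrite /ker_ideal !fmap_comp -mq' -(compA m') -uE -!compA -wE.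
    by rewrite !compA -(compA m') (proj1 kk) compm0 !comp0m.
  exists w'; apply: (kernel_mono kk).
  by rewrite !compA kr wE -aw' fmap_comp compA.
- split=> //; last first.
    exists C, (v ∘ a), (m ∘ k); split; first exact: mono_comp mm (kernel_mono kk).
    by rewrite -compA kr compA mq fmap_comp.
  apply/epiP => Z t tr0.
  (* Every generalized element of [K] comes, after a cover, from [F Q]. *)
  have [V [x [y [ex xy]]]] := epi_pullback abD k eq.
  have [|V' [e [z [ee ez]]]] := aF V y.
    rewrite fmap_comp -mq' -(compA m') -uE -!compA xy.
    by rewrite (compA phi) (proj1 kk) comp0m compm0.
  apply: (epi0 (epi_comp ex ee)).
  rewrite (_ : x ∘ e = r ∘ z) ?compA ?tr0 ?comp0m //.
  by apply: (kernel_mono kk); rewrite !compA -xy kr -!compA ez.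
- by exists a.
Qed.

(** Let [u] lift [phi], and let [X'] be the image of [fmap F v'] for
    [v' : P' ~> C'].  The cone [B] of [v' ∘ u] controls the cokernel of [phi]:
    as [F] is homological, the part of the subobject [X'] of [F C'] that
    [fmap F j] kills is exactly the image of [phi]. *)
Section Cone.
Variables (P P' C' B : T) (X X' : D) (q : F P ~> X) (q' : F P' ~> X').
Variables (phi : X ~> X') (u : P ~> P') (v' : P' ~> C') (m' : X' ~> F C').
Variables (j : C' ~> B) (w : B ~> susp P).
Hypotheses (eq : epi q) (mm' : mono m') (mq' : m' ∘ q' = fmap F v').
Hypothesis uE : phi ∘ q = q' ∘ fmap F u.
Hypothesis jP : exact_triangle (v' ∘ u) j w.

Lemma cone_kills_image : fmap F j ∘ m' ∘ phi = 0.
Proof.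
apply: (epi0 eq); rewrite -!compA uE (compA m') mq' -!fmap_comp.
by rewrite (tri_comp0 jP) fmap0.
Qed.

Lemma cone_presents_cokernel (Z : D) (c : X' ~> Z) : is_cokernel phi c ->
  exists m, mono m /\ m ∘ c = fmap F j ∘ m'.
Proof.
move=> cc; have [m mc] := cokernel_factor cc cone_kills_image.
exists m; split=> //; apply/monoP => W z mz0.
have [V [e [x [ee xz]]]] := epi_pullback abD z (cokernel_epi cc).
have [|V' [e' [y [ee' yx]]]] := hom_lift homF (y := m' ∘ x) jP.
  by rewrite compA -mc -compA xz compA mz0 comp0m.
apply: (epi0 (epi_comp ee ee')).
rewrite compA -xz -compA (_ : x ∘ e' = phi ∘ (q ∘ y)).
  by rewrite compA (proj1 cc) comp0m.
by apply: mm'; rewrite !compA -yx fmap_comp -mq' -(compA m') -uE !compA.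
Qed.

Lemma cone_lift (R : T) (r : R ~> P') : proj R ->
  fmap F j ∘ m' ∘ (q' ∘ fmap F r) = 0 ->
  exists t : R ~> P, q' ∘ fmap F r = phi ∘ (q ∘ fmap F t).
Proof.
move=> pR r0; have [|t vt] := tri_lift jP (g := v' ∘ r).
  apply: pR; rewrite /ker_ideal !fmap_comp -mq'.
  by move: r0; rewrite !compA.
exists t; apply: mm'.
by rewrite !compA -(compA m' phi) uE !compA mq' -!fmap_comp vt.
Qed.

End Cone.

Lemma presentation_cokernel (P P' : T) (X X' Z : D) (q : F P ~> X)
    (q' : F P' ~> X') (phi : X ~> X') (c : X' ~> Z) :
  is_presentation q -> is_presentation q' -> lifts q q' phi ->
  is_cokernel phi c -> is_presentation (c ∘ q').
Proof.
move=> [pP eq _] [pP' eq' [C' [v' [m' [mm' mq']]]]] [u uE] cc.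
have [B [j [w jP]]] := tri_cone (v' ∘ u).
split=> //; first exact: epi_comp (cokernel_epi cc) eq'.
have [m [mm mc]] := cone_presents_cokernel eq mm' mq' uE jP cc.
by exists B, (j ∘ v'), m; split=> //; rewrite compA mc fmap_comp -compA mq'.
Qed.

(** Together with the next two lemmas, this makes monomorphisms kernels and
    epimorphisms cokernels in the category of presented objects: factorizations
    that exist in the target category lift to the presentations. *)
Lemma lifts_mono_cancel (P P' R : T) (X X' Y : D) (q : F P ~> X)
    (q' : F P' ~> X') (s : F R ~> Y) (phi : X ~> X') (h : Y ~> X) :
  is_presentation q -> is_presentation q' -> is_presentation s ->
  lifts q q' phi -> mono phi -> lifts s q' (phi ∘ h) -> lifts s q h.
Proof.
move=> [pP eq _] [pP' eq' [C' [v' [m' [mm' mq']]]]] [pR es _] [u uE] mphi.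
move=> [r rE]; have [B [j [w jP]]] := tri_cone (v' ∘ u).
have [|t tE] := cone_lift mm' mq' uE jP (r := r) pR.
  by rewrite -rE !compA (cone_kills_image eq mq' uE jP) !comp0m.
by exists t; apply: mphi; rewrite -tE -rE compA.
Qed.

(** If [phi] is epic, then [fmap F j] vanishes on [X'], so [j ∘ v' ∘ r], which is
    killed by [F], is zero and [v' ∘ r] factors through [v' ∘ u]. *)
Lemma presentation_epi_lift (P P' R : T) (X X' : D) (q : F P ~> X)
    (q' : F P' ~> X') (phi : X ~> X') (r : R ~> P') :
  is_presentation q -> is_presentation q' -> proj R ->
  lifts q q' phi -> epi phi ->
  exists t : R ~> P, q' ∘ fmap F r = phi ∘ (q ∘ fmap F t).
Proof.
move=> [pP eq _] [pP' eq' [C' [v' [m' [mm' mq']]]]] pR [u uE] ephi.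
have [B [j [w jP]]] := tri_cone (v' ∘ u).
apply: (cone_lift mm' mq' uE jP pR).
by rewrite (epi0 ephi (cone_kills_image eq mq' uE jP)) comp0m.
Qed.

Lemma lifts_epi_cancel (P P' R : T) (X X' Y : D) (q : F P ~> X)
    (q' : F P' ~> X') (s : F R ~> Y) (phi : X ~> X') (h : X' ~> Y) :
  is_presentation q -> is_presentation q' ->
  lifts q q' phi -> epi phi -> lifts q s (h ∘ phi) -> lifts q' s h.
Proof.
move=> qP qP' phiP ephi [r rE]; have [pP' _ _] := qP'.
have [t] := presentation_epi_lift (idm P') qP qP' pP' phiP ephi.
rewrite fmap1 compm1 => tE; exists (r ∘ t).
by rewrite tE !compA rE fmap_comp !compA.
Qed.

Lemma presentation_biproduct (P P' : T) (X X' S : D) (q : F P ~> X)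
    (q' : F P' ~> X') (i1 : X ~> S) (i2 : X' ~> S) (p1 : S ~> X) (p2 : S ~> X') :
  is_presentation q -> is_presentation q' -> is_biproduct i1 i2 p1 p2 ->
  exists Q (r : F Q ~> S), is_presentation r /\
    [/\ lifts q r i1, lifts q' r i2, lifts r q p1 & lifts r q' p2].
Proof.
move=> [pP eq [C [v [m [mm mq]]]]] [pP' eq' [C' [v' [m' [mm' mq']]]]].
move=> [pi11 pi22 pi12 pi21 S1].
have [Q [j1 [j2 [r1 [r2 bQ]]]]] := has_biproducts P P'.
have [B [k1 [k2 [s1 [s2 [sk11 sk22 sk12 sk21 B1]]]]]] := has_biproducts C C'.
have [rj11 rj22 rj12 rj21 Q1] := bQ.
pose r := i1 ∘ q ∘ fmap F r1 + i2 ∘ q' ∘ fmap F r2.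
have rj1 : r ∘ fmap F j1 = i1 ∘ q.
  rewrite compDl -!compA -!fmap_comp rj11 rj21 fmap1 fmap0.
  by rewrite !compm0 compm1 addr0.
have rj2 : r ∘ fmap F j2 = i2 ∘ q'.
  rewrite compDl -!compA -!fmap_comp rj12 rj22 fmap1 fmap0.
  by rewrite !compm0 compm1 add0r.
have pr1 : p1 ∘ r = q ∘ fmap F r1.
  by rewrite compDr !compA pi11 pi12 !comp0m comp1m addr0.
have pr2 : p2 ∘ r = q' ∘ fmap F r2.
  by rewrite compDr !compA pi21 pi22 !comp0m comp1m add0r.
exists Q, r; split; last first.
  by split; [exists j1 | exists j2 | exists r1 | exists r2].
split; first exact: I_projective_biproduct bQ pP pP'.
  apply/epiP => Z g gr0; rewrite -(compm1 g) -S1 compDr !compA.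
  have /(epi0 eq) -> : g ∘ i1 ∘ q = 0 by rewrite -compA -rj1 compA gr0 comp0m.
  have /(epi0 eq') -> : g ∘ i2 ∘ q' = 0 by rewrite -compA -rj2 compA gr0 comp0m.
  by rewrite !comp0m addr0.
exists B, (k1 ∘ v ∘ r1 + k2 ∘ v' ∘ r2).
exists (fmap F k1 ∘ m ∘ p1 + fmap F k2 ∘ m' ∘ p2); split; last first.
  rewrite compDl -!compA pr1 pr2 (compA m) (compA m') mq mq'.
  by rewrite fmapD !fmap_comp.
apply/monoP => W y; rewrite compDl => y0.
have p1y : p1 ∘ y = 0.
  apply: (mono0 mm); rewrite -(comp1m (m ∘ _)) -fmap1 -sk11 fmap_comp.
  have := congr1 (comp (fmap F s1)) y0.
  rewrite compm0 compDr -!compA (compA (fmap F s1) (fmap F k2)).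
  by rewrite -(fmap_comp F s1 k2) sk12 fmap0 comp0m addr0.
have p2y : p2 ∘ y = 0.
  apply: (mono0 mm'); rewrite -(comp1m (m' ∘ _)) -fmap1 -sk22 fmap_comp.
  have := congr1 (comp (fmap F s2)) y0.
  rewrite compm0 compDr -!compA (compA (fmap F s2) (fmap F k1)).
  by rewrite -(fmap_comp F s2 k1) sk21 fmap0 comp0m add0r.
by rewrite -(comp1m y) -S1 compDl -!compA p1y p2y !compm0 addr0.
Qed.

Lemma presentation_zero : exists P (X : D) (q : F P ~> X),
  zero_object X /\ is_presentation q.
Proof.
have [P P0] := has_zero_object T; have [X X0] := has_zero_object D.
have FP0 : zero_object (F P).
  by apply: zero_object_id; rewrite -fmap1 (proj1 P0 P (idm P) 0) fmap0.
exists P, X, 0; split=> //; split.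
- by move=> Y f _; apply: (proj2 P0).
- by move=> Z g h _; apply: (proj2 X0).
exists P, 0, 0; split; last by rewrite fmap0 compm0.
by move=> Z g h _; apply: (proj1 X0).
Qed.

Lemma presentation_susp (P : T) (X : D) (q : F P ~> X) :
  is_presentation q <-> is_presentation (fmap susp q ∘ sfun_susp F P).
Proof.
have iP := sfun_susp_iso F P.
split=> [[pP eq [C [v [m [mm mq]]]]] | [pP eq [C]]].
  have [s [ss s's]] := sfun_susp_iso F C.
  split; first exact: (I_projective_susp F P).1 pP.
    by apply: epi_comp (is_iso_epi iP); apply: susp_epi.
  exists (susp C), (fmap susp v), (s ∘ fmap susp m); split.
    apply/mono_isol; last by apply/susp_mono.
    by exists (sfun_susp F C).
  by rewrite (susp_conj v ss) -mq fmap_comp !compA.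
have [C' ->] := susp_obj C; move=> [v [m [mm mq]]].
have [v' vE] := susp_surj v; have [m' mE] := susp_surj (sfun_susp F C' ∘ m).
have iC := sfun_susp_iso F C'.
split; first exact: (I_projective_susp F P).2 pP.
  apply/epiP => Z g gq0; apply: susp_inj; rewrite fmap0; apply: (epi0 eq).
  by rewrite compA -fmap_comp gq0 fmap0 comp0m.
exists C', v', m'; split.
  by apply/susp_mono; rewrite mE; apply/mono_isol.
apply: susp_inj; apply: (is_iso_epi iP).
by rewrite fmap_comp mE -!compA mq -vE sfun_susp_nat.
Qed.

End Presented.

(** * The category of presented objects *)

Lemma inj_surj_bij (A B : Type) (f : A -> B) :
  injective f -> (forall y, exists x, f x = y) -> bijective f.
Proof.
move=> fi fs; exists (fun y => sval (cid (fs y))) => [x|y].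
  by apply: fi; case: cid.
by case: cid.
Qed.

Section PresentedCategory.
Variables (T : triangulatedCat) (D : stableAbelianCat) (F : stableFunctor T D).

Record presented := Presented {
  pobj : D;
  pcover : T;
  pmap : F pcover ~> pobj;
  pmapP : is_presentation pmap
}.

Implicit Types X Y Z : presented.

Definition liftable X Y : {pred pobj X ~> pobj Y} :=
  fun phi => `[< lifts (pmap X) (pmap Y) phi >].

Fact liftable_zmod_closed X Y : zmod_closed (@liftable X Y).
Proof.
split=> [|f g /asboolP[u uE] /asboolP[v vE]]; apply/asboolP.
  by exists 0; rewrite fmap0 comp0m compm0.
by exists (u - v); rewrite compBl uE vE fmapB compBr.
Qed.

HB.instance Definition _ X Y :=
  GRing.isZmodClosed.Build _ (@liftable X Y) (@liftable_zmod_closed X Y).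

(** A lift, if there is one, is not part of a morphism: the groups of morphisms
    are subgroups of those of [D], and the inclusion into [D] is faithful. *)
Record phom X Y := PHom {
  incl :> pobj X ~> pobj Y;
  _ : incl \in @liftable X Y
}.

HB.instance Definition _ X Y := [isSub for @incl X Y].
HB.instance Definition _ X Y := [Choice of phom X Y by <:].
HB.instance Definition _ X Y := [SubChoice_isSubZmodule of phom X Y by <:].

Lemma inclP X Y (f : phom X Y) : lifts (pmap X) (pmap Y) (incl f).
Proof. by case: f => f fP; apply/asboolP. Qed.

Lemma incl_inj X Y : injective (@incl X Y).
Proof. exact: val_inj. Qed.

Definition phom_of X Y (f : pobj X ~> pobj Y)
  (fP : lifts (pmap X) (pmap Y) f) : phom X Y := PHom (asboolT fP).

Lemma lifts_id X : lifts (pmap X) (pmap X) (idm (pobj X)).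
Proof. by exists (idm _); rewrite fmap1 comp1m compm1. Qed.

Lemma lifts_comp (P Q R : T) (A B C : D) (p : F P ~> A) (q : F Q ~> B)
    (r : F R ~> C) (g : B ~> C) (f : A ~> B) :
  lifts q r g -> lifts p q f -> lifts p r (g ∘ f).
Proof.
move=> [v vE] [u uE]; exists (v ∘ u).
by rewrite fmap_comp compA -vE -!compA uE.
Qed.

Definition presented_precat : preadditiveCat.
Proof.
pose cmp X Y Z (g : phom Y Z) (f : phom X Y) : phom X Z :=
  phom_of (lifts_comp (inclP g) (inclP f)).
exists presented (fun X Y => phom X Y : zmodType)
  (fun X => phom_of (lifts_id X)) cmp.
- by move=> *; apply: incl_inj; rewrite /= compA.
- by move=> *; apply: incl_inj; rewrite /= comp1m.
- by move=> *; apply: incl_inj; rewrite /= compm1.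
- by move=> *; apply: incl_inj; rewrite /= compDl.
- by move=> *; apply: incl_inj; rewrite /= compDr.
Defined.

Definition presented_addcat : additiveCat.
Proof.
exists presented_precat.
  have [P [X [q [[X0 X0'] qP]]]] := presentation_zero F.
  exists (Presented qP); split=> Y f g; apply: incl_inj; [exact: X0|exact: X0'].
move=> X Y; have [S [i1 [i2 [p1 [p2 bS]]]]] := has_biproducts (pobj X) (pobj Y).
have [Q [r [rP [Li1 Li2 Lp1 Lp2]]]] :=
  presentation_biproduct (pmapP X) (pmapP Y) bS.
have [pi11 pi22 pi12 pi21 S1] := bS.
exists (Presented rP), (phom_of (Y := Presented rP) Li1),
  (phom_of (Y := Presented rP) Li2), (phom_of (X := Presented rP) Lp1),
  (phom_of (X := Presented rP) Lp2).
by split; apply: incl_inj.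
Defined.

Definition psusp X : presented :=
  Presented ((presentation_susp (pmap X)).1 (pmapP X)).

Lemma lifts_susp X Y (f : pobj X ~> pobj Y) :
  lifts (pmap X) (pmap Y) f <->
  lifts (pmap (psusp X)) (pmap (psusp Y)) (fmap susp f).
Proof.
split=> [[u uE] | [u]].
  exists (fmap susp u).
  by rewrite /= compA -fmap_comp uE fmap_comp -!compA sfun_susp_nat.
have [v <-] := susp_surj u => /= vE; exists v; apply: susp_inj.
apply: (is_iso_epi (sfun_susp_iso F (pcover X))).
by rewrite !fmap_comp -compA vE -!compA sfun_susp_nat.
Qed.

Definition psusp_functor : functor presented_addcat presented_addcat.
Proof.
exists (psusp : presented_addcat -> presented_addcat)
  (fun X Y (f : phom X Y) => phom_of ((lifts_susp f).1 (inclP f))).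
- by move=> X; apply: incl_inj; apply: fmap1.
- by move=> X Y Z g f; apply: incl_inj; apply: fmap_comp.
- by move=> X Y f g; apply: incl_inj; rewrite /= fmapB.
Defined.

(** Equalities of objects enter as morphisms, so that equalities between the
    dependent fields of [presented] can be composed and mapped by functors. *)
Definition eq_hom (C : preadditiveCat) (A B : C) (e : A = B) : A ~> B :=
  match e with erefl => idm A end.

Lemma fmap_eq_hom (C C' : preadditiveCat) (G : functor C C') (A B : C) (e : A = B)
  (e' : G A = G B) : fmap G (eq_hom e) = eq_hom e'.
Proof.
by move: e'; case: B / e => e'; rewrite (Prop_irrelevance e' erefl) /= fmap1.
Qed.

Lemma psusp_inj : injective psusp.
Proof.
move=> X Y e.
have [eX [eP]] : exists (eX : pobj (psusp X) = pobj (psusp Y))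
    (eP : pcover (psusp X) = pcover (psusp Y)),
    eq_hom eX ∘ pmap (psusp X) = pmap (psusp Y) ∘ fmap F (eq_hom eP).
  case: _ / e; exists erefl, erefl; by rewrite fmap1 comp1m compm1.
have eX' : pobj X = pobj Y := can_inj (@suspK D) eX.
have eP' : pcover X = pcover Y := can_inj (@suspK T) eP.
rewrite -(fmap_eq_hom (G := susp) eX') -(fmap_eq_hom (G := susp) eP') /=.
rewrite compA -fmap_comp -compA sfun_susp_nat compA -fmap_comp.
move=> /(is_iso_epi (sfun_susp_iso F (pcover X)))/susp_inj.
clear; move: eX' eP'; case: X => X P q qP; case: Y => Y Q r rP /= eX eP.
move: r rP; case: Y / eX => r; move: r; case: Q / eP => r rP /=.
rewrite fmap1 comp1m compm1 => qr; move: rP; rewrite -qr => rP.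
by rewrite (Prop_irrelevance qP rP).
Qed.

Lemma psusp_surj Y : exists X, psusp X = Y.
Proof.
case: Y => Y Q r rP.
have [X eX] := susp_obj Y; have [P eP] := susp_obj Q.
move: r rP; rewrite eX eP => r rP {Y eX Q eP}.
have [s [sl sr]] := sfun_susp_iso F P.
have [q qE] := susp_surj (r ∘ s).
have rE : fmap susp q ∘ sfun_susp F P = r by rewrite qE -compA sl compm1.
have qP : is_presentation q by apply/presentation_susp; rewrite rE.
exists (Presented qP); rewrite /psusp /=; move: rP; rewrite -rE => rP.
by congr Presented; apply: Prop_irrelevance.
Qed.

Definition presented_stcat : stableCat.
Proof.
exists presented_addcat psusp_functor (fun Y => sval (cid (psusp_surj Y))).
- by move=> X; apply: psusp_inj; case: cid.
- by move=> X /=; case: cid.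
move=> X Y; apply: inj_surj_bij => [f g /(congr1 (@incl _ _))/susp_inj|g].
  exact: incl_inj.
have [f fE] := susp_surj (incl (g : phom (psusp X) (psusp Y))).
have fP : lifts (pmap X) (pmap Y) f by apply/lifts_susp; rewrite fE; apply: inclP.
by exists (phom_of fP); apply: incl_inj.
Defined.

Definition incl_functor : functor presented_precat D.
Proof.
by exists pobj (fun X Y (f : phom X Y) => incl f) => // X Y; apply: raddfB.
Defined.

Hypothesis homF : homological F.
Hypothesis enoughP : enough_projectives (ker_ideal F).

Local Notation E := (presented_addcat : additiveCat).
Implicit Types A B C : E.

Lemma exists_presented_kernel A B (f : A ~> B) : exists (K : E) (k : K ~> A),
  is_kernel f k /\ is_kernel (incl f) (incl k).
Proof.
have [K0 [k0 kk]] := has_kernel (stcat_abelian D) (incl f).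
have [Q [r [rP kL kU]]] :=
  presentation_kernel homF enoughP (pmapP A) (pmapP B) (inclP f) kk.
pose K : E := Presented rP; pose k : K ~> A := phom_of (X := K) kL.
exists K, k; split=> //; apply: is_kernelI.
- move=> W g h /(congr1 (@incl _ _)) gh.
  by apply: incl_inj; apply: (kernel_mono kk).
- by apply: incl_inj; apply: (proj1 kk).
move=> W g /(congr1 (@incl _ _))/(kernel_factor kk)[h kh].
have hL : lifts (pmap W) r h.
  by apply: (kU _ _ _ _ (pmapP W)); rewrite kh; apply: inclP.
by exists (phom_of (Y := K) hL); apply: incl_inj.
Qed.

Lemma exists_presented_cokernel A B (f : A ~> B) : exists (Q : E) (q : B ~> Q),
  is_cokernel f q /\ is_cokernel (incl f) (incl q).
Proof.
have [Q0 [q0 qq]] := has_cokernel (stcat_abelian D) (incl f).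
have qP := presentation_cokernel homF (pmapP A) (pmapP B) (inclP f) qq.
pose Q : E := Presented qP.
have qL : lifts (pmap B) (pmap Q) q0 by exists (idm _); rewrite fmap1 compm1.
pose q : B ~> Q := phom_of qL.
exists Q, q; split=> //; apply: is_cokernelI.
- move=> W g h /(congr1 (@incl _ _)) gh.
  by apply: incl_inj; apply: (cokernel_epi qq).
- by apply: incl_inj; apply: (proj1 qq).
move=> W g /(congr1 (@incl _ _))/(cokernel_factor qq)[h hq].
have hL : lifts (pmap Q) (pmap W) h.
  by have [u uE] := inclP g; exists u; rewrite /= compA hq.
by exists (phom_of hL); apply: incl_inj.
Qed.

Lemma incl_mono A B (f : A ~> B) : mono f <-> mono (incl f).
Proof.
split=> mf; last first.
  by move=> W g h /(congr1 (@incl _ _)) gh; apply: incl_inj; apply: mf.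
have [K [k [kk kk']]] := exists_presented_kernel f.
have k0 : k = 0 by apply: (mono0 mf) (proj1 kk).
by apply/monoP => W g /(kernel_factor kk')[h <-]; rewrite k0 comp0m.
Qed.

Lemma incl_epi A B (f : A ~> B) : epi f <-> epi (incl f).
Proof.
split=> ef; last first.
  by move=> W g h /(congr1 (@incl _ _)) gh; apply: incl_inj; apply: ef.
have [Q [q [qq qq']]] := exists_presented_cokernel f.
have q0 : q = 0 by apply: (epi0 ef) (proj1 qq).
by apply/epiP => W g /(cokernel_factor qq')[h <-]; rewrite q0 compm0.
Qed.

Lemma presented_abelian : abelian E.
Proof.
split=> A B f.
- by have [K [k [kk _]]] := exists_presented_kernel f; exists K, k.
- by have [K [k [kk _]]] := exists_presented_cokernel f; exists K, k.
- move=> mf; have [Q [q [qq qq']]] := exists_presented_cokernel f.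
  exists Q, q; apply: is_kernelI => //; first exact: (proj1 qq).
  have mf' := (incl_mono f).1 mf.
  move=> W g /(congr1 (@incl _ _)) qg0.
  have [_ _ /(_ _ _ _ mf')[Z [c cc]] _] := stcat_abelian D.
  have [|h hE] := kernel_factor (g := incl g) cc.
    have [t <-] := cokernel_factor qq' (proj1 cc).
    by rewrite -compA; move: qg0 => /= ->; rewrite compm0.
  have hL : lifts (pmap W) (pmap A) h.
    apply: (lifts_mono_cancel (pmapP A) (pmapP B) (pmapP W) (inclP f)) => //.
    by rewrite hE; apply: inclP.
  by exists (phom_of hL); apply: incl_inj.
move=> ef; have [K [k [kk kk']]] := exists_presented_kernel f.
exists K, k; apply: is_cokernelI => //; first exact: (proj1 kk).
have ef' := (incl_epi f).1 ef.
move=> W g /(congr1 (@incl _ _)) gk0.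
have [|h hE] := epi_factor (stcat_abelian D) (g := incl g) ef'.
  move=> V x /(kernel_factor kk')[y <-].
  by rewrite compA; move: gk0 => /= ->; rewrite comp0m.
have hL : lifts (pmap B) (pmap W) h.
  apply: (lifts_epi_cancel (pmapP A) (pmapP B) (inclP f)) => //.
  by rewrite hE; apply: inclP.
by exists (phom_of hL); apply: incl_inj.
Qed.

Definition presented_cat : stableAbelianCat :=
  @StableAbelianCat presented_stcat presented_abelian.

Definition incl_stable : stableFunctor presented_cat D.
Proof.
exists incl_functor (fun X => idm _) => [X|X Y f]; first exact: is_iso_id.
by rewrite /= comp1m compm1.
Defined.

Lemma incl_iso A B (f : A ~> B) : is_iso (incl f) -> is_iso f.
Proof.
move=> fi; apply: (@mono_epi_iso presented_addcat presented_abelian).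
  exact/incl_mono/is_iso_mono.
exact/incl_epi/is_iso_epi.
Qed.

Lemma incl_is_iso A B (f : A ~> B) : is_iso f -> is_iso (incl f).
Proof. exact: (@is_iso_fmap _ _ incl_functor A B f). Qed.

Lemma incl_kernel A B C (f : A ~> B) (k : C ~> A) :
  is_kernel f k -> is_kernel (incl f) (incl k).
Proof.
move=> kk; have [K [k' [kk1 kk2]]] := exists_presented_kernel f.
have [h [ih <-]] := kernel_unique kk1 kk.
exact: kernel_iso kk2 (incl_is_iso ih) _.
Qed.

Lemma incl_cokernel A B C (f : A ~> B) (q : B ~> C) :
  is_cokernel f q -> is_cokernel (incl f) (incl q).
Proof.
move=> qq; have [K [q' [qq1 qq2]]] := exists_presented_cokernel f.
have [h [ih <-]] := cokernel_unique qq1 qq.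
exact: cokernel_iso qq2 (incl_is_iso ih) _.
Qed.

Lemma incl_exact : exact_functor (incl_stable : functor presented_cat D).
Proof.
move=> A B C f g [J [m [[Q [q [qq km]] ] kg]]].
exists (pobj J), (incl m); split; last exact: incl_kernel kg.
exists (pobj Q), (incl q); split; [exact: incl_cokernel | exact: incl_kernel].
Qed.

(** The image of [f] formed in the category of presented objects is a kernel of
    [g] in [D].  So it agrees there with the kernel of [g] among presented
    objects, by a comparison morphism that lifts; and a morphism that lifts and is
    invertible in [D] has an inverse that lifts. *)
Lemma incl_exact_reflect A B C (f : A ~> B) (g : B ~> C) :
  exact_at (incl f) (incl g) -> exact_at f g.
Proof.
move=> [J [m [[Q [q [qq km]]] kg]]].
have [Q' [q' [qq1 qq2]]] := exists_presented_cokernel f.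
have [K [k [kk1 kk2]]] := exists_presented_kernel q'.
have [L [l [ll1 ll2]]] := exists_presented_kernel g.
have [t [[t' [tt' t't]] tE]] := cokernel_unique qq qq2.
have kJ : is_kernel q (incl k).
  apply: is_kernelI; first exact: kernel_mono kk2.
    by rewrite -(comp1m q) -tt' -!compA (compA t) tE (proj1 kk2) compm0.
  move=> W x qx0; apply: (kernel_factor kk2).
  by rewrite -tE -compA qx0 compm0.
have [s [is_ sE]] := kernel_unique km kJ.
have [h' [ih' h'E]] := kernel_unique ll2 (kernel_iso kg is_ sE).
have gk0 : g ∘ k = 0.
  by apply: incl_inj; rewrite /= -sE compA (proj1 kg) comp0m.
have [h hE] := kernel_factor ll1 gk0.
exists K, k; split; first by exists Q', q'.
apply: (kernel_iso ll1 _ hE); apply: incl_iso.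
suff -> : incl h = h' by [].
by apply: (kernel_mono ll2); rewrite h'E -hE.
Qed.

(** * The functor to the category of presented objects *)

Lemma I_epic_presentation P (X : T) (f : P ~> X) :
  I_projective (ker_ideal F) P -> I_epic (ker_ideal F) f ->
  is_presentation (fmap F f).
Proof.
move=> pP ef; split=> //; first exact: I_epic_epi.
by exists X, f, (idm _); rewrite comp1m; split=> // ? ? ?; rewrite !comp1m.
Qed.

Definition cover (X : T) : T := sval (cid (enoughP X)).
Definition cover_map (X : T) : cover X ~> X := sval (cid (svalP (cid (enoughP X)))).

Lemma coverP (X : T) : I_projective (ker_ideal F) (cover X).
Proof. by case: (svalP (cid (svalP (cid (enoughP X))))). Qed.

Lemma cover_map_epic (X : T) : I_epic (ker_ideal F) (cover_map X).
Proof. by case: (svalP (cid (svalP (cid (enoughP X))))). Qed.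

Definition present_obj (X : T) : presented_cat :=
  Presented (I_epic_presentation (@coverP X) (@cover_map_epic X)).

Lemma lifts_fmap (X Y : T) (f : X ~> Y) :
  lifts (pmap (present_obj X)) (pmap (present_obj Y)) (fmap F f).
Proof.
have [u uE] := I_epic_lift (f ∘ cover_map X) (cover_map_epic Y) (@coverP X).
by exists u; rewrite /= -!fmap_comp uE.
Qed.

(** The chosen cover of [susp X] need not be the suspension of that of [X]. *)
Lemma lifts_sfun_susp (X : T) : lifts (pmap (present_obj (susp X)))
  (pmap (psusp (present_obj X))) (sfun_susp F X).
Proof.
have [u uE] := I_epic_lift_susp (cover_map (susp X)) (cover_map_epic X)
  (@coverP (susp X)).
by exists u; rewrite /= -uE -sfun_susp_nat fmap_comp compA.
Qed.

Definition present_functor : functor T presented_cat.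
Proof.
exists present_obj (fun (X Y : T) f => phom_of (lifts_fmap f)).
- by move=> X; apply: incl_inj; apply: fmap1.
- by move=> X Y Z g f; apply: incl_inj; apply: fmap_comp.
- by move=> X Y f g; apply: incl_inj; apply: fmap_additive.
Defined.

Definition present : stableFunctor T presented_cat.
Proof.
exists present_functor (fun X : T => phom_of (lifts_sfun_susp X)) => [X|X Y f].
  by apply: incl_iso; apply: sfun_susp_iso.
by apply: incl_inj; apply: sfun_susp_nat.
Defined.

Lemma present_homological : homological present.
Proof. by move=> X Y Z u v w /homF uv; apply: incl_exact_reflect. Qed.

Lemma present_exact : I_exact (ker_ideal F) present.
Proof. by move=> X Y f f0; apply: incl_inj. Qed.

End PresentedCategory.

(** * Consequences of universality *)

Section ExactFunctor.
Variables (C D : stableAbelianCat) (R : functor C D).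

Lemma exact_functor_epi (X Y : C) (e : X ~> Y) :
  exact_functor R -> epi e -> epi (fmap R e).
Proof.
move=> exR ee.
have : exact_at e (0 : Y ~> Y).
  exists Y, (idm Y); split; last first.
    apply: is_kernelI => [||W g _]; first exact: is_iso_mono (is_iso_id Y).
      by rewrite comp0m.
    by exists g; rewrite comp1m.
  have [Z Z0] := has_zero_object C; exists Z, 0; split.
    apply: is_cokernelI => [V g h _||W g]; [by apply: (proj2 Z0) | |].
      by rewrite comp0m.
    by move=> /(epi0 ee) ->; exists 0; rewrite comp0m.
  apply: is_kernelI => [||W g _]; first exact: is_iso_mono (is_iso_id Y).
    by rewrite comp0m.
  by exists g; rewrite comp1m.
move=> /exR; rewrite fmap0 => ex.
have [|V [x [y [ex' xy]]]] :=
  exact_lift (stcat_abelian D) (y := idm _) ex; first by rewrite comp0m.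
by apply: (@epi_compl _ _ _ _ _ y); rewrite xy comp1m.
Qed.

Definition id_functor : functor C C.
Proof. by exists (fun X => X) (fun X Y f => f). Defined.

Definition id_stable : stableFunctor C C.
Proof.
exists id_functor (fun X => idm _) => [X|X Y f]; first exact: is_iso_id.
by rewrite /= comp1m compm1.
Defined.

End ExactFunctor.

Section Universal.
Variables (T : triangulatedCat) (D : stableAbelianCat) (F : stableFunctor T D).
Hypothesis univF : universal_I_exact (ker_ideal F) F.
Hypothesis enoughP : enough_projectives (ker_ideal F).
Local Notation proj := (I_projective (ker_ideal F)).

Let homF : homological F := let: And3 h _ _ := univF in h.
Local Notation E := (presented_cat homF enoughP).
Local Notation G := (present homF enoughP).
Local Notation W := (incl_stable homF enoughP).

(** The identity and [R] followed by the inclusion are exact functors whose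
    composites with [F] are isomorphic to [F], so uniqueness of factorizations
    through [F] identifies them. *)
Lemma universal_retract : exists (R : functor D E)
    (theta : forall X : T, R (F X) ~> G X) (eta : forall X : D, W (R X) ~> X),
  [/\ exact_functor R, forall X, is_iso (theta X), forall X, is_iso (eta X),
      forall (X Y : T) (f : X ~> Y),
        theta Y ∘ fmap R (fmap F f) = fmap G f ∘ theta X
    & forall (X Y : D) (f : X ~> Y),
        eta Y ∘ fmap W (fmap R f) = f ∘ eta X].
Proof.
have [_ exF uF] := univF.
have [[R [exR [theta [isoth natth suspth]]]] _] :=
  uF E G (present_homological homF enoughP) (present_exact homF enoughP).
have [_ uniq] := uF D F homF exF.
have exid : exact_functor (id_stable D) by [].
have exWR : exact_functor (comp_stable W R).
  by move=> X Y Z f g /exR; apply: incl_exact.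
have [||eta [isoeta nateta]] := uniq (comp_stable W R) (id_stable D) exWR exid.
- exists (fun X => incl (theta X)); split=> [X|X Y f|X].
  + exact: incl_is_iso (isoth X).
  + exact: (congr1 (@incl _ _ _ _ _) (natth X Y f)).
  have := congr1 (@incl _ _ _ _ _) (suspth X).
  by rewrite /= comp1m.
- exists (fun X => idm _); split=> [X|X Y f|X]; first exact: is_iso_id.
    by rewrite /= comp1m compm1.
  by rewrite /= fmap1 compm1 !comp1m.
by exists R, theta, eta; split.
Qed.

(** The chosen cover of a projective object is a split epimorphism. *)
Lemma liftable_from_projective (P : T) (Y : E) (f : (G P : E) ~> Y) : proj P ->
  exists w : P ~> pcover Y, incl f = pmap Y ∘ fmap F w.
Proof.
move=> pP; have [w /= wE] := inclP f.
have [s sE] := I_epic_lift (idm P) (cover_map_epic enoughP P) pP.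
exists (w ∘ s).
by rewrite fmap_comp compA -wE -compA -fmap_comp sE fmap1 compm1.
Qed.

(** [R] replaces [phi] by a morphism of presented objects; this one lifts to the
    covers, hence is [F] of some [f] since the cover of [P] splits.  The
    isomorphism [eta] between the identity and [R] followed by the inclusion
    transports the equality [phi = fmap F f] back to the target of [F]. *)
Lemma universal_full (P B : T) (phi : F P ~> F B) : proj P ->
  exists f : P ~> B, fmap F f = phi.
Proof.
move=> pP.
have [R [theta [eta [exR isoth isoeta natth nateta]]]] := universal_retract.
have [th' [th'l th'r]] := isoth P.
have [w wE] := liftable_from_projective (theta B ∘ fmap R phi ∘ th') pP.
pose f := cover_map enoughP B ∘ w; exists f.
have fE : fmap G f ∘ theta P = theta B ∘ fmap R phi.
  rewrite -(compm1 (fmap R phi)) -th'l !compA; congr (_ ∘ _).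
  by apply: incl_inj; rewrite wE /f /= fmap_comp.
apply: (is_iso_epi (isoeta (F P))); rewrite -!nateta; congr (_ ∘ fmap W _).
by apply: (is_iso_mono (isoth B)); rewrite natth.
Qed.

(** An epimorphism is carried by [R] to an epimorphism of presented objects, along
    which morphisms from covers can be lifted. *)
Lemma universal_projective (P : T) : proj P -> projective (F P).
Proof.
move=> pP Y Z e f ee.
have [R [theta [eta [exR isoth isoeta natth nateta]]]] := universal_retract.
have [th' [th'l th'r]] := isoth P.
have [w wE] := liftable_from_projective (fmap R f ∘ th') pP.
have eRe : epi (incl (fmap R e)).
  apply: (exact_functor_epi (@incl_exact _ _ _ homF enoughP)).
  exact: exact_functor_epi exR ee.
have [t tE] := presentation_epi_lift w (pmapP _) (pmapP _) pP (inclP _) eRe.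
have [eta' [eta'l eta'r]] := isoeta (F P).
exists (eta Y ∘ (pmap (R Y) ∘ fmap F t) ∘ incl (theta P) ∘ eta').
rewrite !compA -nateta -!compA (compA (pmap (R Y))) (compA (fmap W _)).
rewrite [X in _ ∘ (X ∘ _)](_ : _ = incl (fmap R f ∘ th')); last by rewrite wE tE.
rewrite [X in _ ∘ X](_ : _ = fmap W (fmap R f) ∘ eta'); last first.
  rewrite compA; congr (_ ∘ _).
  transitivity (incl (fmap R f ∘ th' ∘ theta P)) => //.
  by rewrite -compA th'l compm1.
by rewrite compA nateta -compA eta'r compm1.
Qed.

Lemma universal_cover (X : D) : exists P (q : F P ~> X), proj P /\ epi q.
Proof.
have [R [theta [eta [exR isoth isoeta natth nateta]]]] := universal_retract.
have [pP eq _] := pmapP (R X).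
exists (pcover (R X)), (eta X ∘ pmap (R X)); split=> //.
exact: epi_comp (is_iso_epi (isoeta X)) eq.
Qed.

(** A projective object is a retract of some [F P], and the idempotent of [F P]
    is the image of an idempotent of [P] that splits. *)
Lemma universal_realize (hT : has_countable_sums T) (Q : D) : projective Q ->
  exists P (q : F P ~> Q), proj P /\ is_iso q.
Proof.
move=> pQ; have [P [r [pP er]]] := universal_cover Q.
have [s rs] := pQ _ _ r (idm Q) er.
have [e eE] := universal_full (s ∘ r) pP.
have ee : e ∘ e = e.
  apply: (I_projective_inj pP).
  by rewrite fmap_comp eE -compA (compA r) rs comp1m.
have [V [a [b [ab ba]]]] := idempotent_split hT ee.
exists V, (r ∘ fmap F a); split.
  move=> B f f0; rewrite -(compm1 f) -ba compA (pP _ (f ∘ b)) ?comp0m //.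
  by rewrite /ker_ideal fmap_comp f0 comp0m.
exists (fmap F b ∘ s); split.
  rewrite -compA (compA s) -eE -ab -!fmap_comp -!compA ba compm1.
  by rewrite ba fmap1.
rewrite -compA (compA (fmap F a)) -fmap_comp ab eE.
by rewrite -compA rs compm1 rs.
Qed.

End Universal.

(** * Syzygies *)

Section Syzygy.
Variables (D : stableAbelianCat) (A : D).
Let abD : abelian D := stcat_abelian D.

Lemma exact_mono_kernel (X Y Z : D) (f : X ~> Y) (g : Y ~> Z) :
  exact_at f g -> mono f -> is_kernel g f.
Proof.
move=> [J [m [im km]]] mf; have [f' [ef' mf']] := image_factor abD im.
apply: (kernel_iso km _ mf'); apply: (mono_epi_iso abD) => //.
by move=> W a b ab; apply: mf; rewrite -mf' -!compA ab.
Qed.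

(** Comparing the two resolutions in degrees 0 and 1 exhibits the second syzygy
    of [P] as a retract of the sum of [Q 2] and [P 1]; this is used directly on
    lifting problems, without forming the sum. *)
Lemma second_syzygy_projective (P Q : projective_resolution A)
    (Q3 : zero_object (Q 3)) (O : D) (i : O ~> P 1) :
  is_kernel (res_d P 0) i -> projective O.
Proof.
move=> ki.
have mQ : mono (res_d Q 1).
  apply/monoP => W y y0.
  have [V [e [x [ee xe]]]] := exact_lift abD (res_exact Q 1) y0.
  by apply: (epi0 ee); rewrite -xe (proj1 Q3 _ x 0) compm0.
have kQ := exact_mono_kernel (res_exact Q 0) mQ.
have P10 := exact_comp0 (res_exact0 P); have Q10 := exact_comp0 (res_exact0 Q).
have Q21 := exact_comp0 (res_exact Q 0).
have [a0 a0E] := @res_projective _ _ Q 0 _ _ _ (res_aug Q) (res_aug_epi (p := P)).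
have [b0 b0E] := @res_projective _ _ P 0 _ _ _ (res_aug P) (res_aug_epi (p := Q)).
have [|a1 a1E] := projective_lift abD (y := a0 ∘ res_d Q 0)
  (@res_projective _ _ Q 1) (res_exact0 P); first by rewrite compA a0E.
have [|b1 b1E] := projective_lift abD (y := b0 ∘ res_d P 0)
  (@res_projective _ _ P 1) (res_exact0 Q); first by rewrite compA b0E.
have [|s sE] := projective_lift abD (y := a0 ∘ b0 - idm _)
  (@res_projective _ _ P 0) (res_exact0 P).
  by rewrite compBr compA a0E b0E compm1 subrr.
have [|a aE] := kernel_factor (g := a1 ∘ res_d Q 1) ki.
  by rewrite compA a1E -compA Q21 compm0.
have [|b bE] := kernel_factor (g := b1 ∘ i) kQ.
  by rewrite compA b1E -compA (proj1 ki) compm0.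
have [|t tE] := kernel_factor (g := a1 ∘ b1 - idm _ - s ∘ res_d P 0) ki.
  rewrite !compBr !compA a1E sE compm1 -compA b1E compBl comp1m compA.
  by rewrite subrr.
have retr : a ∘ b - t ∘ i = idm O.
  apply: (kernel_mono ki); rewrite compBr !compA aE tE -compA bE.
  rewrite !compBl comp1m -(compA s) (proj1 ki) compm0 subr0 compA opprB.
  by rewrite addrC subrK compm1.
move=> Y Z e f ee.
have [y1 y1E] := @res_projective _ _ Q 2 _ _ _ (f ∘ a) ee.
have [y2 y2E] := @res_projective _ _ P 1 _ _ _ (f ∘ t) ee.
exists (y1 ∘ b - y2 ∘ i).
by rewrite compBr !compA y1E y2E -!compA -compBr retr compm1.
Qed.

End Syzygy.

(** * The invariant of a lifting *)

Section Classification.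
Variables (T : triangulatedCat) (D : stableAbelianCat) (F : stableFunctor T D).
Hypothesis homF : homological F.
Local Notation proj := (I_projective (ker_ideal F)).
Hypothesis full : forall (P B : T) (phi : F P ~> F B), proj P ->
  exists f : P ~> B, fmap F f = phi.
Hypothesis projF : forall P : T, proj P -> projective (F P).

Let abD : abelian D := stcat_abelian D.

Variables (A : D) (P0 P1 P2 : T) (d0 : P1 ~> P0) (d1 : P2 ~> P1).
Variable (eps : F P0 ~> A).
Hypotheses (pP0 : proj P0) (pP1 : proj P1) (pP2 : proj P2).
Hypothesis eps_epi : epi eps.
Hypothesis eps_d0 : eps ∘ fmap F d0 = 0.
Hypothesis eps_lift : forall W (y : W ~> F P0), eps ∘ y = 0 ->
  exists V (e : V ~> W) (x : V ~> F P1), epi e /\ fmap F d0 ∘ x = y ∘ e.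
Hypothesis d1_ker : is_kernel (fmap F d0) (fmap F d1).

Variables (M : T) (j : P1 ~> M) (k : M ~> susp P2).
Hypothesis d1jk : exact_triangle d1 j k.
Variable g0 : M ~> P0.
Hypothesis g0j : g0 ∘ j = d0.

Implicit Types L : lifting (ker_ideal F) F A.

Lemma eps_lift_projective W (y : W ~> F P0) : projective W -> eps ∘ y = 0 ->
  exists x, fmap F d0 ∘ x = y.
Proof.
move=> pW /eps_lift[V [e [x [ee xE]]]].
have [s es] := pW _ _ e (idm W) ee.
by exists (x ∘ s); rewrite compA xE -compA es compm1.
Qed.

Lemma j_epi : epi (fmap F j).
Proof. exact: (triangle_mono_epi homF d1jk).1 (kernel_mono d1_ker). Qed.

Lemma j_lift W (y : W ~> F M) : exists V (e : V ~> W) (x : V ~> F P1),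
  epi e /\ fmap F j ∘ x = y ∘ e.
Proof. exact: (epi_pullback abD y j_epi). Qed.

Lemma orth_middle : contractible_orth F M.
Proof. exact: orth_cone d1jk (I_projective_orth pP2) (I_projective_orth pP1). Qed.

Lemma twist_j x : (g0 + x ∘ k) ∘ j = d0.
Proof.
by rewrite compDl g0j -compA (tri_comp0 (tri_rotate d1jk)) compm0 addr0.
Qed.

Section Cone.
Variables (g : M ~> P0) (gj : g ∘ j = d0).

(** In terms of elements, [F M] is the cokernel of [fmap F d1], that is, the image
    of [fmap F d0]. *)
Lemma connecting_mono : mono (fmap F g).
Proof.
apply/monoP => W y gy0; have [V [e [x [ee xy]]]] := j_lift y.
have [|z zE] := kernel_factor (g := x) d1_ker.
  by rewrite -gj fmap_comp -compA xy compA gy0 comp0m.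
apply: (epi0 ee); rewrite -xy -zE compA -fmap_comp (tri_comp0 d1jk).
by rewrite fmap0 comp0m.
Qed.

Variables (C : T) (p : P0 ~> C) (w : C ~> susp M).
Hypothesis gpw : exact_triangle g p w.

Lemma cone_epi : epi (fmap F p).
Proof. exact: (triangle_mono_epi homF gpw).1 connecting_mono. Qed.

(** Both [eps] and [fmap F p] are cokernels of [fmap F d0]. *)
Lemma cone_iso : exists a : F C ~> A, is_iso a /\ a ∘ fmap F p = eps.
Proof.
have [|a aE] := epi_factor abD (g := eps) cone_epi.
  move=> W x px0; have [V [e [y [ee ye]]]] := hom_lift homF gpw px0.
  have [V' [e' [z [ee' zE]]]] := j_lift y.
  apply: (epi0 (epi_comp ee ee')).
  rewrite compA -(compA eps) -ye -!compA -zE (compA (fmap F g)) -fmap_comp gj.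
  by rewrite compA eps_d0 comp0m.
have [|b bE] := epi_factor abD (g := fmap F p) eps_epi.
  move=> W x /eps_lift[V [e [y [ee ye]]]].
  apply: (epi0 ee); rewrite -compA -ye -gj compA -fmap_comp compA (tri_comp0 gpw).
  by rewrite comp0m fmap0 comp0m.
exists a; split=> //; exists b; split.
  by apply: cone_epi; rewrite -compA aE bE comp1m.
by apply: eps_epi; rewrite -compA bE aE comp1m.
Qed.

Lemma cone_orth : contractible_orth F C.
Proof. exact: orth_cone gpw orth_middle (I_projective_orth pP0). Qed.

End Cone.

(** The invariant of a lifting relative to [g0], as a relation: [xi] is well
    defined only up to the ambiguity described in [coded_equiv]. *)
Definition coded L (xi : F (susp P2) ~> A) : Prop :=
  exists (x : susp P2 ~> P0) (p : P0 ~> lift_obj L) (w : lift_obj L ~> susp M),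
    [/\ exact_triangle (g0 + x ∘ k) p w, lift_map L ∘ fmap F p = eps
      & xi = eps ∘ fmap F x].

Let psP2 : proj (susp P2) := (I_projective_susp F P2).1 pP2.
Let psP1 : proj (susp P1) := (I_projective_susp F P1).1 pP1.

Lemma eps_lift_T (P : T) (xi : F P ~> A) : proj P ->
  exists x : P ~> P0, eps ∘ fmap F x = xi.
Proof.
move=> pP; have [y yE] := projF pP xi eps_epi.
by have [x xE] := full y pP; exists x; rewrite xE.
Qed.

Lemma coded_surj xi : exists L, coded L xi.
Proof.
have [x xE] := eps_lift_T xi psP2.
have [C [p [w gpw]]] := tri_cone (g0 + x ∘ k).
have [a [ia aE]] := cone_iso (twist_j x) gpw.
by exists (Lifting (cone_orth gpw) ia), x, p, w.
Qed.

(** Cover the lifting by [P0], its fiber [N] by [P1]; the fiber [K] of the second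
    cover is isomorphic to [P2].  Comparing the last triangle with that of [d1]
    identifies [N] with [M]. *)
Lemma coded_total L : exists xi, coded L xi.
Proof.
case: L => C oC a ia.
have [a' [a'a aa']] := ia.
have [p pE] := full (a' ∘ eps) pP0.
have aF : a ∘ fmap F p = eps by rewrite pE compA aa' comp1m.
have p_epi : epi (fmap F p).
  by rewrite pE; apply: epi_comp eps_epi; apply: is_iso_epi; exists a.
have [N [m [w mpw]]] := tri_fiber p.
have m_mono : mono (fmap F m) by apply/(triangle_mono_epi homF mpw).
have [|n nm] := tri_lift mpw (g := d0).
  apply: (I_projective_inj pP1); rewrite fmap_comp fmap0.
  by apply: (is_iso_mono ia); rewrite compA aF eps_d0 compm0.
have n_epi : epi (fmap F n).
  have [|V [e [x [ee xE]]]] := @eps_lift _ (fmap F m).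
    by rewrite -aF -compA -fmap_comp (tri_comp0 mpw) fmap0 compm0.
  apply: (@epi_compl _ _ _ _ _ x); rewrite (_ : _ ∘ x = e) //.
  by apply: m_mono; rewrite compA -fmap_comp nm.
have [K [l [v lnv]]] := tri_fiber n.
have l_mono : mono (fmap F l) by apply/(triangle_mono_epi homF lnv).
have l_ker : is_kernel (fmap F d0) (fmap F l).
  apply: is_kernelI => // [|W y y0].
    by rewrite -nm -fmap_comp -compA (tri_comp0 lnv) compm0 fmap0.
  have ny0 : fmap F n ∘ y = 0.
    by apply: (mono0 m_mono); rewrite compA -fmap_comp nm.
  exact: (kernel_factor (exact_mono_kernel (homF lnv) l_mono) ny0).
have [h [ih hE]] := kernel_unique l_ker d1_ker.
have [r rE] := full h pP2.
have lr : l ∘ r = d1 by apply: (I_projective_inj pP2); rewrite fmap_comp rE.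
have oN : contractible_orth F N by apply: orth_fiber mpw (I_projective_orth pP0) oC.
have oK : contractible_orth F K by apply: orth_fiber lnv (I_projective_orth pP1) oN.
have ir : is_iso r.
  by apply: (orth_whitehead homF (I_projective_orth pP2) oK); rewrite rE.
have [|t [tj tk]] := tri_mor (f := r) (g := idm P1) d1jk lnv.
  by rewrite comp1m lr.
have Ft_mono : mono (fmap F t).
  apply/monoP => W y ty0; have [V [e [x [ee xy]]]] := j_lift y.
  have [|z zE] := kernel_factor (g := x) d1_ker.
    rewrite -nm fmap_comp -(compm1 n) -tj fmap_comp -!compA xy.
    by rewrite (compA (fmap F t)) ty0 comp0m compm0.
  apply: (epi0 ee).
  by rewrite -xy -zE compA -fmap_comp (tri_comp0 d1jk) fmap0 comp0m.
have it : is_iso t.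
  apply: (orth_whitehead homF orth_middle oN); apply: (mono_epi_iso abD) => //.
  by apply: (@epi_compl _ _ _ _ _ (fmap F j)); rewrite -fmap_comp tj compm1.
have [t' [t't tt']] := it.
have [|x xE] := tri_extend (tri_rotate d1jk) (g := m ∘ t - g0).
  by rewrite compBl -compA tj compm1 nm g0j subrr.
exists (eps ∘ fmap F x), x, p, (fmap susp t' ∘ w); split=> //.
rewrite xE addrC subrK.
apply: tri_iso (t') (idm P0) (idm C) _ _ _ _ _ _ mpw.
- by exists t.
- exact: is_iso_id.
- exact: is_iso_id.
- by rewrite comp1m -compA tt' compm1.
- by rewrite comp1m compm1.
- by rewrite compm1.
Qed.

(** An equivalence of liftings induces an endomorphism of [M] that [F] does not
    distinguish from the identity.  It changes [x] by a term killed by [eps] and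
    by a morphism that factors through [fmap susp d1].  Conversely, if the
    invariants differ by a morphism that factors through [fmap susp d1], then the
    two morphisms [M ~> P0] differ by the automorphism [idm M + j ∘ z ∘ k] of
    [M], where [k ∘ j = 0] makes [j ∘ z ∘ k] square to zero. *)
Lemma coded_equiv L L' xi xi' : coded L xi -> coded L' xi' ->
  (lifting_equiv L L' <->
   exists h : F (susp P1) ~> A, xi' - xi = h ∘ fmap F (fmap susp d1)).
Proof.
have kj : k ∘ j = 0 := tri_comp0 (tri_rotate d1jk).
have dk : fmap susp d1 ∘ k = 0.
  have := tri_comp0 (tri_rotate (tri_rotate d1jk)).
  by rewrite compNm => /eqP; rewrite oppr_eq0 => /eqP.
case: L => C oC a ia; case: L' => C' oC' a' ia'.
move=> [x [p [w [gpw /= aE ->]]]] [x' [p' [w' [gpw' /= aE' ->]]]].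
have gj := twist_j x; have gj' := twist_j x'.
have p_epi := cone_epi gj gpw; have p_epi' := cone_epi gj' gpw'.
split=> [[phi [/= _ phiE]] | [h hE]].
  have phip : phi ∘ p = p'.
    apply: (I_projective_inj pP0); apply: (is_iso_mono ia').
    by rewrite fmap_comp compA -phiE aE aE'.
  have [|t gt] := tri_lift gpw' (g := g0 + x ∘ k).
    by rewrite -phip -compA (tri_comp0 gpw) compm0.
  have Ft : fmap F t = idm _.
    apply: (connecting_mono gj'); apply: j_epi.
    by rewrite -fmap_comp gt compm1 -!fmap_comp gj gj'.
  have [|s sE] := tri_extend (tri_rotate d1jk) (g := idm M - t).
    apply: (I_projective_inj pP1).
    by rewrite fmap_comp fmapB Ft fmap1 subrr comp0m fmap0.
  have [|y yE] := tri_extend (tri_rotate (tri_rotate d1jk))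
      (g := x' - x - (g0 + x' ∘ k) ∘ s).
    rewrite !compBl -compA sE compBr compm1 gt.
    rewrite [X in _ - X](_ : _ = x' ∘ k - x ∘ k) ?subrr //.
    by rewrite opprD addrACA subrr add0r.
  exists (- (eps ∘ fmap F y)).
  have epsg : eps ∘ fmap F (g0 + x' ∘ k) = 0.
    by rewrite -aE' -compA -fmap_comp (tri_comp0 gpw') fmap0 compm0.
  have -> : - (eps ∘ fmap F y) ∘ fmap F (fmap susp d1) =
      eps ∘ fmap F (y ∘ - fmap susp d1).
    by rewrite compmN fmapN compmN compNm fmap_comp compA.
  by rewrite yE !fmapB !compBr fmap_comp (compA eps) epsg comp0m subr0.
have [y yE] := eps_lift_T h psP1.
have [z zE] : exists z : susp P2 ~> P1, x' - x = y ∘ fmap susp d1 + d0 ∘ z.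
  have [|z zE] := @eps_lift_projective _
    (fmap F (x' - x - y ∘ fmap susp d1)) (projF psP2).
    by rewrite !fmapB !compBr hE fmap_comp compA yE subrr.
  have [z' z'E] := full z psP2; exists z'; apply: (I_projective_inj psP2).
  by rewrite [RHS]fmapD (fmap_comp F d0) z'E zE -fmapD [in RHS]addrC subrK.
have t_iso : is_iso (idm M + j ∘ z ∘ k).
  have n0 : j ∘ z ∘ k ∘ (j ∘ z ∘ k) = 0.
    by rewrite !compA -(compA (j ∘ z)) kj compm0 !comp0m.
  move: (j ∘ z ∘ k) n0 => n n0; exists (idm M - n); split.
    by rewrite compBl comp1m compDr compm1 n0 addr0 addrK.
  by rewrite compDl comp1m compBr compm1 n0 subr0 subrK.
have gt : g0 + x' ∘ k = (g0 + x ∘ k) ∘ (idm M + j ∘ z ∘ k).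
  rewrite compDr compm1 !compA gj -addrA; congr (_ + _).
  rewrite -(subrK x x') zE addrC compDl; congr (_ + _).
  by rewrite compDl -(compA y) dk compm0 add0r.
have [|phi phip] := tri_extend gpw (g := p').
  have [t' [t't tt']] := t_iso.
  rewrite -(compm1 (g0 + x ∘ k)) -tt' (compA (g0 + x ∘ k)) -gt compA.
  by rewrite (tri_comp0 gpw') comp0m.
have aphi : a = a' ∘ fmap F phi.
  by apply: p_epi; rewrite -compA -fmap_comp phip aE aE'.
exists phi; split=> //; apply: (orth_whitehead homF) => //.
have [b [ba ab]] := ia; have [b' [ba' ab']] := ia'.
rewrite -(comp1m (fmap F phi)) -ba' -compA -aphi.
by apply: is_iso_comp => //; exists a'.
Qed.

End Classification.

(** * Liftings and Ext *)

Lemma sval_inj (X : Type) (Q : X -> Prop) : injective (@sval X Q).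
Proof. by move=> [x xQ] [y yQ] /= e; apply: eq_exist. Qed.

(** The correspondence [Phi] need not be functional; that [R] is an equivalence
    relation follows from its being matched with [S]. *)
Lemma class_bijection (X Y : Type) (R : X -> X -> Prop) (S : Y -> Y -> Prop)
    (Phi : X -> Y -> Prop) :
  (forall y, S y y) -> (forall y y', S y y' -> S y' y) ->
  (forall y y' y'', S y y' -> S y' y'' -> S y y'') ->
  (forall x, exists y, Phi x y) -> (forall y, exists x, Phi x y) ->
  (forall x x' y y', Phi x y -> Phi x' y' -> R x x' <-> S y y') ->
  exists f : classes_of R -> classes_of S, bijective f.
Proof.
move=> Srefl Ssym Strans tot surj PhiE.
have Seq y y' : S y y' -> S y = S y'.
  move=> yy'; apply: funext => z; apply: propext; split; apply: Strans => //.
  exact: Ssym.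
have Req x x' y y' : Phi x y -> Phi x' y' -> S y y' -> R x = R x'.
  move=> xy xy' yy'; apply: funext => z; have [t zt] := tot z.
  by apply: propext; rewrite (PhiE _ _ _ _ xy zt) (PhiE _ _ _ _ xy' zt) (Seq y y').
pose rep (c : classes_of R) : X := sval (cid (svalP c)).
have repE c : sval c = R (rep c) by rewrite /rep; case: cid.
pose val x : Y := sval (cid (tot x)).
have valP x : Phi x (val x) by rewrite /val; case: cid.
pose f (c : classes_of R) : classes_of S :=
  exist _ (S (val (rep c))) (ex_intro _ _ erefl).
exists f; apply: inj_surj_bij.
  move=> c c' /(congr1 sval) /= e; apply: sval_inj; rewrite !repE.
  by apply: (Req _ _ _ _ (valP _) (valP _)); rewrite e.
move=> [c [y cE]]; have [x xy] := surj y.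
exists (exist _ (R x) (ex_intro _ x erefl)); apply: sval_inj => /=.
rewrite cE; apply: Seq; apply/(PhiE _ _ _ _ (valP _) xy).
by rewrite -repE /=; apply/(PhiE _ _ _ _ xy xy).
Qed.

Section Lift.
Variables (T : triangulatedCat) (D : stableAbelianCat) (F : stableFunctor T D).
Variable A : D.
Hypothesis hT : has_countable_sums T.
Hypothesis enoughP : enough_projectives (ker_ideal F).
Hypothesis univF : universal_I_exact (ker_ideal F) F.
Hypothesis hA : cohomological_dimension A 2.
Variable P : projective_resolution A.
Let abD : abelian D := stcat_abelian D.
Let homF : homological F := let: And3 h _ _ := univF in h.

Lemma liftings_Ext : exists f : classes_of (@lifting_equiv T (ker_ideal F) D F A) ->
  Ext P (desusp A) 2, bijective f.
Proof.
have [Q Qzero] := hA.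
have [O [i ki]] := has_kernel abD (res_d P 0).
have pO := second_syzygy_projective (Qzero 3 isT) ki.
have P10 := exact_comp0 (res_exact0 P); have P21 := exact_comp0 (res_exact P 0).
have P32 := exact_comp0 (res_exact P 1).
have [q qE] := kernel_factor ki P21.
have q_epi : epi q.
  have [V [e [x [ee xE]]]] := exact_lift abD (res_exact P 0) (proj1 ki).
  apply: (@epi_compl _ _ _ _ _ x); rewrite (_ : q ∘ x = e) //.
  by apply: (kernel_mono ki); rewrite compA qE xE.
have [R0 [t0 [pR0 it0]]] := universal_realize univF enoughP hT
  (@res_projective _ _ P 0).
have [R1 [t1 [pR1 it1]]] := universal_realize univF enoughP hT
  (@res_projective _ _ P 1).
have [R2 [t2 [pR2 it2]]] := universal_realize univF enoughP hT pO.
have [t0' [t0l t0r]] := it0; have [t1' [t1l t1r]] := it1.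
have [t2' [t2l t2r]] := it2.
have full := universal_full univF enoughP.
have projF := universal_projective univF enoughP.
have [d0 d0E] := full _ _ (t0' ∘ res_d P 0 ∘ t1) pR1.
have [d1 d1E] := full _ _ (t1' ∘ i ∘ t2) pR2.
pose eps := res_aug P ∘ t0.
have eps_epi : epi eps := epi_comp (res_aug_epi (p := P)) (is_iso_epi it0).
have eps_d0 : eps ∘ fmap F d0 = 0.
  by rewrite d0E /eps -!compA (compA t0) t0r comp1m compA P10 comp0m.
have t0d0 : t0 ∘ fmap F d0 = res_d P 0 ∘ t1.
  by rewrite d0E !compA t0r comp1m.
have t1d1 : t1 ∘ fmap F d1 = i ∘ t2.
  by rewrite d1E !compA t1r comp1m.
have eps_lift W (y : W ~> F R0) : eps ∘ y = 0 ->
  exists V (e : V ~> W) (x : V ~> F R1), epi e /\ fmap F d0 ∘ x = y ∘ e.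
  rewrite /eps -compA => y0.
  have [V [e [x [ee xE]]]] := exact_lift abD (res_exact0 P) y0.
  exists V, e, (t1' ∘ x); split=> //; apply: (is_iso_mono it0).
  by rewrite compA t0d0 -compA (compA t1) t1r comp1m xE compA.
have d1_ker : is_kernel (fmap F d0) (fmap F d1).
  apply: is_kernelI => [||W y y0].
  - rewrite d1E; apply: mono_comp (is_iso_mono it2).
    apply: mono_comp (kernel_mono ki).
    by apply: is_iso_mono; exists t1.
  - apply: (is_iso_mono it0).
    by rewrite compA t0d0 -compA t1d1 compA (proj1 ki) comp0m compm0.
  have [|h hE] := kernel_factor (g := t1 ∘ y) ki.
    by rewrite compA -t0d0 -compA y0 compm0.
  exists (t2' ∘ h); apply: (is_iso_mono it1).
  by rewrite compA t1d1 -compA (compA t2) t2r comp1m hE.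
have [M [j [k d1jk]]] := tri_cone d1.
have [|g0 g0j] := tri_extend d1jk (g := d0).
  by apply: (I_projective_inj pR2); rewrite fmap_comp fmap0 (proj1 d1_ker).
(* Cocycles on [P 2] are the morphisms that factor through [tau], so that [Ext] is
   the cokernel of [Hom(F R1, _) -> Hom(F R2, _)]. *)
pose tau := t2' ∘ q.
have tau_epi : epi tau by apply: epi_comp q_epi; apply: is_iso_epi; exists t2.
have d1tau : fmap F d1 ∘ tau = t1' ∘ res_d P 1.
  by rewrite d1E /tau -!compA (compA t2) t2r comp1m qE.
have tau_factor B (f : P 2 ~> B) : f ∘ res_d P 2 = 0 -> exists g, g ∘ tau = f.
  move=> f0; apply: (epi_factor abD tau_epi) => W x x0.
  have [|V [e [y [ee yE]]]] := exact_lift abD (y := x) (res_exact P 1).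
    apply: (is_iso_mono (f := t1')); first by exists t1.
    by rewrite compA -d1tau -compA x0 !compm0.
  by apply: (epi0 ee); rewrite -compA -yE compA f0 comp0m.
have tau_d : tau ∘ res_d P 2 = 0.
  apply: (kernel_mono d1_ker).
  by rewrite compA d1tau -compA P32 !compm0.
(* The isomorphism [c] stands for the equality [desuspK A]. *)
have [c [c' [c'c cc']]] : exists c : susp (desusp A) ~> A, is_iso c.
  by rewrite desuspK; exists (idm A); apply: is_iso_id.
pose s X := sfun_susp F X; have is_ X : is_iso (s X) := sfun_susp_iso F X.
have [s2' [s2l s2r]] := is_ R2; have [s1' [s1l s1r]] := is_ R1.
pose code (g : F R2 ~> desusp A) : F (susp R2) ~> A := c ∘ fmap susp g ∘ s R2.
have codeB g g' : code g' - code g = code (g' - g).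
  by rewrite /code fmapB compBr compBl.
have code_d1 g : (exists h, g = h ∘ fmap F d1) <->
    exists h, code g = h ∘ fmap F (fmap susp d1).
  split=> [[h ->] | [h hE]].
    exists (c ∘ fmap susp h ∘ s R1).
    by rewrite /code fmap_comp -!compA sfun_susp_nat.
  have [h' h'E] := susp_surj (c' ∘ h ∘ s1').
  exists h'; apply: susp_inj; apply: (is_iso_epi (is_ R2)).
  apply: (is_iso_mono (f := c)); first by exists c'.
  rewrite compA -/(code g) hE fmap_comp h'E -!compA -sfun_susp_nat.
  by rewrite (compA s1') s1l comp1m (compA c) cc' comp1m.
pose Phi (L : lifting (ker_ideal F) F A) (f : cocycle P (desusp A) 2) :=
  exists g, sval f = g ∘ tau /\ coded eps k g0 L (code g).
apply: (@class_bijection _ _ _ _ Phi).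
- by move=> f; exists 0; rewrite subrr comp0m.
- by move=> f f' [h hE]; exists (- h); rewrite compNm -hE opprB.
- move=> f f' f'' [h hE] [h' h'E]; exists (h' + h).
  by rewrite compDl -hE -h'E addrA subrK.
- move=> L.
  have [xi codL] := coded_total homF full pR0 pR1 pR2 eps_epi eps_d0 eps_lift
    d1_ker d1jk g0j L.
  have [g gE] := susp_surj (c' ∘ xi ∘ s2').
  have f0 : g ∘ tau ∘ res_d P 2 = 0 by rewrite -compA tau_d compm0.
  exists (exist _ (g ∘ tau) f0), g; split=> //.
  by rewrite /code gE !compA cc' comp1m -compA s2l compm1.
- move=> [f f0]; have [g gE] := tau_factor _ f f0.
  have [L codL] := coded_surj homF full projF pR0 pR1 pR2 eps_epi eps_d0 eps_lift
    d1_ker d1jk g0j (code g).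
  by exists L, g.
move=> L L' [f f0] [f' f0'] [g [/= -> codL]] [g' [/= -> codL']].
rewrite (coded_equiv homF full projF pR0 pR1 pR2 eps_epi eps_lift
  d1_ker d1jk g0j codL codL') codeB -code_d1 -compBl.
split=> [[h ->] | [h hE]].
  by exists (h ∘ t1'); rewrite -!compA d1tau.
exists (h ∘ t1); apply: tau_epi.
by rewrite hE -!compA d1tau (compA t1) t1r comp1m.
Qed.

End Lift.

Theorem theorem2p6
    (T : triangulatedCat) (hT : has_countable_sums T)
    (I : morphism_class T)
    (hI : stable_homological_ideal I)
    (hsum : compatible_with_countable_sums I)
    (hproj : enough_projectives I)
    (D : stableAbelianCat) (F : stableFunctor T D)
    (hF : universal_I_exact I F)
    (A : D) (hA : cohomological_dimension A 2)
    (P : projective_resolution A) :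
  exists f : classes_of (@lifting_equiv T I D F A) -> Ext P (desusp A) 2,
    bijective f.
Proof.
(* The functor that defines [I] factors through [F]. *)
have IE : I = ker_ideal F.
  have [E [H [homH HI]]] := hI; have [_ exF uF] := hF.
  have [|[R [exR [eta [isoeta nateta _]]]] _] := uF E H homH.
    by move=> X Y f /HI.
  do 3![apply: functional_extensionality_dep => ?]; apply: propext.
  split=> [|f0]; first exact: exF.
  apply/HI; apply: (epi0 (is_iso_epi (isoeta _))).
  by rewrite -nateta /= f0 fmap0 compm0.
subst I; exact: liftings_Ext.
Qed.
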